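(* Let $\mathcal L$ be a two-dimensional skip-free semi-irreducible MMRRW ($d=2$, $D=\{1,2\}$) with irreducible class $\mathcal S_0$, each of whose induced Markov chains $\mathcal L^{\{1\}},\mathcal L^{\{2\}},\mathcal L^D$ is either semi-irreducible and stable, or transient. Assume $(\{0\}\times\{0\}\times S^\emptyset)\cap\mathcal S_0\neq\emptyset$. (C1) When $a^D(1)<0$ and $a^D(2)<0$, $\mathcal L$ is (a) stable if $a^{\{1\}}(1)<0$ and $a^{\{2\}}(2)<0$; (b) unstable if either $a^{\{1\}}(1)>0$ or $a^{\{2\}}(2)>0$. (C2) When $a^D(1)>0$ and $a^D(2)<0$, $\mathcal L$ is (a) stable if $a^{\{1\}}(1)<0$; (b) unstable if $a^{\{1\}}(1)>0$. (C3) When $a^D(1)<0$ and $a^D(2)>0$, $\mathcal L$ is (a) stable if $a^{\{2\}}(2)<0$; (b) unstable if $a^{\{2\}}(2)>0$. (C4) When $a^D(1)>0$ and $a^D(2)>0$, $\mathcal L$ is unstable.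
   Context: Notation (used with $d=2$): $D=\{1,\dots,d\}$; $\mathcal P(A)$ is the set of all subsets of $A$ (including $\emptyset$); for $x\in\mathbb R^d$, $x(l)$ is the $l$-th coordinate and $x(A)=(x(l))_{l\in A}$; relations between a vector and a number, such as $x(A)>0$, hold coordinatewise (vacuously if $A=\emptyset$). For $A\in\mathcal P(D)$ let $\mathcal B^A=\{x\in\mathbb R_+^d: x(A)>0,\ x(D\setminus A)=0\}$ and let $S^A=\{1,\dots,s^A\}$ be a nonempty finite set. MMRRW. A $d$-dimensional skip-free Markov modulated reflecting random walk (MMRRW) $\mathcal L=\{Y_n\}=\{(X_n,J_n)\}$ is a discrete-time homogeneous Markov chain on $\mathcal S=\bigcup_{A\in\mathcal P(D)}(\mathcal B^A\cap\mathbb Z^d)\times S^A$ such that $X_{n+1}-X_n\in\{-1,0,1\}^d$ and, whenever $x\in\mathcal B^A\cap\mathbb Z^d$, $z\in\{-1,0,1\}^d$, $x+z\in\mathcal B^B\cap\mathbb Z^d$, $i\in S^A$, $j\in S^B$, the probability $\mathbb P(Y_{n+1}=(x+z,j)\mid Y_n=(x,i))=p_z^{A,B}(i,j)$ depends only on $A,B,z,i,j$. Semi-irreducibility and stability (for any countable-state Markov chain). The chain is semi-irreducible if it has exactly one irreducible (closed communicating) class $\mathcal S_0$ and every state of $\mathcal S_0$ is accessible from every state. A semi-irreducible chain is stable if $\mathcal S_0$ is positive recurrent and from every state outside $\mathcal S_0$ the first passage time to $\mathcal S_0$ is a.s. finite with finite expectation. It is unstable if either $\mathcal S_0$ is transient,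 or there is a state outside $\mathcal S_0$ from which, with positive probability, $\mathcal S_0$ is never reached. Expanded and induced chains. Let $\emptyset\ne A\in\mathcal P(D)$. For $B\in\mathcal P(D\setminus A)$ let $\hat{\mathcal B}^{A,B}=\{x\in\mathbb R^d: x(B)>0,\ x(D\setminus(A\cup B))=0\}$ ($x(A)$ arbitrary). The expanded chain $\hat{\mathcal L}^A=\{Y^A_n\}=\{(X^A_n,J^A_n)\}$ is the Markov chain on $\hat{\mathcal S}^A=\bigcup_{B\in\mathcal P(D\setminus A)}(\hat{\mathcal B}^{A,B}\cap\mathbb Z^d)\times S^{A\cup B}$ with $\mathbb P(Y^A_{n+1}=(x+z,j)\mid Y^A_n=(x,i))=p_z^{A\cup B,A\cup C}(i,j)$ for $x\in\hat{\mathcal B}^{A,B}\cap\mathbb Z^d$, $z\in\{-1,0,1\}^d$, $x+z\in\hat{\mathcal B}^{A,C}\cap\mathbb Z^d$, $i\in S^{A\cup B}$, $j\in S^{A\cup C}$. The process $\mathcal L^A=\{(X^A_n(D\setminus A),J^A_n)\}$ is itself a Markov chain (a $(d-|A|)$-dimensional MMRRW; a finite chain if $A=D$), called the induced Markov chain with index $A$. ''$\mathcal L^A$ is transient'' means that all its states are transient (semi-irreducibility not required). If $\mathcal L^A$ is semi-irreducible and stable, the mean drift vector is $a^A=\lim_{n\to\infty}\frac1n(X^A_n-X^A_0)\in\mathbb R^d$ (a.s. limit, nonrandom); equivalently, it is the expectation of the one-step conditional mean increment vector of $X^A$ under the stationary distribution of $\mathcal L^A$. The chain $\mathcal L^D$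 is always stable, $\mathcal L^{\{1\}}$ is stable if $a^D(2)<0$, and $\mathcal L^{\{2\}}$ is stable if $a^D(1)<0$, so all drift vectors used in the claim exist. *)

(* Defs.v *)
From mathcomp Require Import all_boot all_order all_algebra.
From mathcomp Require Import all_classical all_reals all_analysis.
Set Implicit Arguments.
Unset Strict Implicit.
Unset Printing Implicit Defensive.
Import Order.TTheory GRing.Theory Num.Theory.
Import numFieldNormedType.Exports.
Local Open Scope ring_scope.

Section CountableChain.
Context {R : realType} {T : choiceType}.
Implicit Types (P : T -> T -> R) (C : set T).

Definition stochastic P : Prop :=
  (forall x y, 0 <= P x y) /\
  (forall x, \esum_(y in [set: T]%classic) (P x y)%:E = 1%E).

Fixpoint nstep P (n : nat) (x y : T) : \bar R :=
  if n is m.+1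
  then (\esum_(z in [set: T]%classic) ((P x z)%:E * nstep P m z y))%E
  else ((x == y)%:R)%:E.

Definition accessible P (x y : T) : Prop :=
  exists n, (0 < nstep P n x y)%E.

Definition irreducible_class P C : Prop :=
  [/\ exists x, C x,
      forall x y, C x -> accessible P x y -> C y &
      forall x y, C x -> C y -> accessible P x y].

(* C is the unique irreducible class, and it is accessible from everywhere. *)
Definition semi_irreducible P C : Prop :=
  [/\ irreducible_class P C,
      forall C', irreducible_class P C' -> C' = C &
      forall x y, C y -> accessible P x y].

(* P_x (tau_C = n + 1), where tau_C = inf {n >= 1 : Y_n in C}. *)
Fixpoint first_passage P C (n : nat) (x : T) : \bar R :=
  if n is m.+1
  then (\esum_(y in (~` C)%classic) ((P x y)%:E * first_passage P C m y))%E
  else (\esum_(y in C) (P x y)%:E)%E.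

(* P_x (tau_C < oo) *)
Definition passage_prob P C (x : T) : \bar R :=
  (\sum_(0 <= n <oo) first_passage P C n x)%E.

(* E_x [tau_C; tau_C < oo] *)
Definition mean_passage P C (x : T) : \bar R :=
  (\sum_(0 <= n <oo) (n.+1%:R%:E * first_passage P C n x))%E.

Definition transient P (x : T) : Prop :=
  (passage_prob P [set x]%classic x < 1)%E.

Definition positive_recurrent P (x : T) : Prop :=
  passage_prob P [set x]%classic x = 1%E /\
  (mean_passage P [set x]%classic x < +oo)%E.

(* In the next two definitions C is meant to be the irreducible class of a
   semi-irreducible chain. *)
Definition stable P C : Prop :=
  (forall x, C x -> positive_recurrent P x) /\
  (forall x, ~ C x -> passage_prob P C x = 1%E /\
                      (mean_passage P C x < +oo)%E).

Definition unstable P C : Prop :=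
  (forall x, C x -> transient P x) \/
  (exists x, ~ C x /\ (passage_prob P C x < 1)%E).

(* Y is a time-homogeneous Markov chain with transition matrix P and arbitrary
   initial law. *)
Definition markov_chain {dO : measure_display} {Omega : measurableType dO}
    (Pr : probability Omega R) P (Y : nat -> Omega -> T) : Prop :=
  (forall n x, measurable [set w | Y n w = x]%classic) /\
  (forall n (x : nat -> T),
     Pr [set w | forall k, (k <= n.+1)%N -> Y k w = x k]%classic =
     (Pr [set w | forall k, (k <= n)%N -> Y k w = x k]%classic *
      (P (x n) (x n.+1))%:E)%E).

End CountableChain.

Section Kernels.
Context {R : realType} {d : nat}.
Variable s : {set 'I_d} -> nat.

(* Increments z in {-1,0,1}^d are coded by values k in {0,1,2} standing for
   k - 1, so that they form a finite type. *)
Definition step : finType := {ffun 'I_d -> 'I_3}.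
Definition incr (z : step) (l : 'I_d) : int := (z l)%:Z - 1.

(* p A B z i j is the probability of moving by z from phase i of the face B^A
   to phase j of the face B^B. *)
Definition jump_probs : Type :=
  forall A B : {set 'I_d}, step -> 'I_(s A) -> 'I_(s B) -> R.
Variable p : jump_probs.

Definition walk_face (x : {ffun 'I_d -> nat}) : {set 'I_d} :=
  finset (fun l => (0 < x l)%N).

Definition walk_state : countType :=
  {x : {ffun 'I_d -> nat} & 'I_(s (walk_face x))}.

Definition walk_kernel (u v : walk_state) : R :=
  \sum_(z : step | [forall l, (tag v l)%:Z == (tag u l)%:Z + incr z l])
    p z (tagged u) (tagged v).

Definition expanded_pos (A : {set 'I_d}) : countType :=
  {x : {ffun 'I_d -> int} | [forall l, (l \notin A) ==> (0 <= x l)]}.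

(* A :|: B for the B such that x lies in \hat B^{A,B} *)
Definition expanded_face A (x : expanded_pos A) : {set 'I_d} :=
  A :|: finset (fun l => 0 < sval x l).

Definition expanded_state (A : {set 'I_d}) : countType :=
  {x : expanded_pos A & 'I_(s (expanded_face x))}.

Definition expanded_coord A (u : expanded_state A) (l : 'I_d) : int :=
  sval (tag u) l.

Definition expanded_kernel A (u v : expanded_state A) : R :=
  \sum_(z : step |
      [forall l, expanded_coord v l == expanded_coord u l + incr z l])
    p z (tagged u) (tagged v).

(* The vector x(D \ A) is represented by its extension by 0 on A. *)
Definition induced_pos (A : {set 'I_d}) : countType :=
  {x : {ffun 'I_d -> nat} | [forall l, (l \in A) ==> (x l == 0%N)]}.

Definition induced_face A (x : induced_pos A) : {set 'I_d} :=
  A :|: finset (fun l => (0 < sval x l)%N).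

Definition induced_state (A : {set 'I_d}) : countType :=
  {x : induced_pos A & 'I_(s (induced_face x))}.

(* The law of (X^A(D \ A), J^A): only the increment off A is prescribed, and
   the increment on A is summed out. *)
Definition induced_kernel A (u v : induced_state A) : R :=
  \sum_(z : step | [forall l, (l \notin A) ==>
      ((sval (tag v) l)%:Z == (sval (tag u) l)%:Z + incr z l)])
    p z (tagged u) (tagged v).

End Kernels.

Arguments step : clear implicits.

(* Only the p A B z realised by transitions of the walk are constrained; these
   are also the only ones that the expanded and induced chains use. *)
Record mmrrw (R : realType) (d : nat) := Mmrrw {
  phases : {set 'I_d} -> nat;
  phases_gt0 : forall A, (0 < phases A)%N;
  jump : @jump_probs R d phases;
  jump_stochastic : stochastic (walk_kernel jump)
}.

Section Mmrrw.
Context {R : realType} {d : nat}.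
Variable L : mmrrw R d.

Definition state : countType := walk_state (phases L).
Definition transition : state -> state -> R := walk_kernel (@jump R d L).

Definition induced_semi_irreducible_stable (A : {set 'I_d}) : Prop :=
  exists C, semi_irreducible (induced_kernel (@jump R d L) (A := A)) C /\
            stable (induced_kernel (@jump R d L) (A := A)) C.

Definition induced_transient (A : {set 'I_d}) : Prop :=
  forall u, transient (induced_kernel (@jump R d L) (A := A)) u.

(* a = lim_n (X^A_n - X^A_0) / n almost surely, for every expanded chain
   Y^A = (X^A, J^A), whatever its initial law. *)
Definition mean_drift (A : {set 'I_d}) (a : 'I_d -> R) : Prop :=
  forall (dO : measure_display) (Omega : measurableType dO)
    (Pr : probability Omega R) (Y : nat -> Omega -> expanded_state (phases L) A),
  markov_chain Pr (expanded_kernel (@jump R d L) (A := A)) Y ->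
  {ae Pr, forall w, forall l,
     ((fun n : nat => (expanded_coord (Y n w) l -
                       expanded_coord (Y 0%N w) l)%:~R / n%:R)
        @ \oo --> a l)%classic}.

End Mmrrw.

Arguments transition {R d} L u v.

(* Main.v *)
Require Import Defs.
From mathcomp Require Import all_boot all_order all_algebra.
From mathcomp Require Import all_classical all_reals all_analysis.
From mathcomp Require Import measurable_realfun.
From mathcomp Require Import ring lra zify.
Import Order.TTheory GRing.Theory Num.Theory.
Import numFieldNormedType.Exports.
Set Implicit Arguments.
Unset Strict Implicit.
Unset Printing Implicit Defensive.
Local Open Scope ring_scope.

(* By dominated convergence along a chain built on the unit interval, a mean
   drift a^A is the limit of the mean increments E_u[X^A_n - X^A_0] / n from every
   starting state u.  Let f be a linear functional with f(a^D) < 0, and suppose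
   that either L^{l} is stable with f(a^{l}) < 0, or L^{l} is transient, hence
   spends a bounded mean time near its boundary.  Then the mean n-step increments
   of f along the expanded chain with index {l} are at most C - e n, uniformly in
   the starting state, and averaging them over n < N yields a bounded corrector w
   such that f + w has a uniformly negative one-step drift.

   Stability: take a quadratic form x^T Q x whose two partial derivatives on the
   quadrant are functionals of this kind, the l-th one for the index {l}, and add
   2 x_l w_l for each l.  Near an axis the drift in the transversal direction
   plays no role since a^{l}(l') <= 0 when a^D(l') < 0.  The result satisfies
   Foster's criterion.

   Instability: exp(- t (f + w)), for small t and f + w drifting upwards, is a
   supermartingale away from the axis x_l = 0 where it exceeds 1, so the origin is
   avoided with positive probability from far away.  The same criterion shows that
   a^D(l') > 0 excludes the stability of L^{l}, and a bounded occupation time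
   shows that a^D(l') < 0 excludes its transience. *)

(** * Finite-branching Markov chains *)

Section Mean.
Context {R : realType} {T : Type} {I : finType}.
Variables (wt : T -> I -> R) (mv : T -> I -> T).
Implicit Types (g h : T -> R) (x : T).

Definition expect g x : R := \sum_i wt x i * g (mv x i).
Notation mean := expect.

(** Here and in the comparison lemmas below, only moves of nonzero weight are constrained: [mv] may
    take junk values where the weight vanishes. *)
Lemma eq_mean g h x : (forall i, wt x i != 0 -> g (mv x i) = h (mv x i)) ->
  mean g x = mean h x.
Proof.
move=> gh; apply: eq_bigr => i _.
by have [->|w0] := eqVneq (wt x i) 0; rewrite ?mul0r// gh.
Qed.

Lemma meanD g h x : mean (fun y => g y + h y) x = mean g x + mean h x.
Proof. by rewrite -big_split; apply: eq_bigr => i _; rewrite mulrDr. Qed.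

Lemma meanZ c g x : mean (fun y => c * g y) x = c * mean g x.
Proof. by rewrite mulr_sumr; apply: eq_bigr => i _; rewrite mulrCA. Qed.

Lemma meanB g h x : mean (fun y => g y - h y) x = mean g x - mean h x.
Proof. by rewrite -sumrB; apply: eq_bigr => i _; rewrite mulrBr. Qed.

Lemma mean_sum (J : Type) (r : seq J) (P : pred J) (g : J -> T -> R) x :
  mean (fun y => \sum_(j <- r | P j) g j y) x =
  \sum_(j <- r | P j) mean (g j) x.
Proof.
rewrite /expect exchange_big; apply: eq_bigr => i _.
by rewrite mulr_sumr.
Qed.

Lemma mean_cst c x : \sum_i wt x i = 1 -> mean (fun=> c) x = c.
Proof. by move=> w1; rewrite /expect -mulr_suml w1 mul1r. Qed.

Hypothesis wt_ge0 : forall x i, 0 <= wt x i.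

Lemma le_mean g h x : (forall i, wt x i != 0 -> g (mv x i) <= h (mv x i)) ->
  mean g x <= mean h x.
Proof.
move=> gh; apply: ler_sum => i _.
have [->|w0] := eqVneq (wt x i) 0; rewrite ?mul0r// ler_wpM2l //.
exact: gh.
Qed.

Lemma mean_ge0 g x : (forall i, wt x i != 0 -> 0 <= g (mv x i)) -> 0 <= mean g x.
Proof.
move=> g0; apply: sumr_ge0 => i _.
have [->|w0] := eqVneq (wt x i) 0; rewrite ?mul0r// mulr_ge0 //.
exact: g0.
Qed.

Lemma mean_ge_term g x i : (forall y, 0 <= g y) ->
  wt x i * g (mv x i) <= mean g x.
Proof.
move=> g0; rewrite /expect (bigD1 i) //= lerDl sumr_ge0 // => j _.
by rewrite mulr_ge0.
Qed.

End Mean.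

Section FiniteBranching.
Context {R : realType} {T : choiceType} {I : finType}.
Variables (wt : T -> I -> R) (mv : T -> I -> T).
Implicit Types (g h V phi : T -> R) (x y v : T) (C D : set T).
Notation mean := (expect wt mv).

(** Several indices may lead to the same state, hence the sum over a fibre. Finiteness of the index
    type turns all sums over the state space into finite sums. *)
Definition branching_kernel x y : R := \sum_(i | mv x i == y) wt x i.
Notation K := branching_kernel.

Hypothesis wt_ge0 : forall x i, 0 <= wt x i.

Lemma branching_kernel_ge0 x y : 0 <= K x y.
Proof. by apply: sumr_ge0. Qed.

(** By nonnegativity the sum over states and the finite sum over moves can be exchanged; for a fixed
    move only the state it leads to contributes. *)
Lemma esum_branching D (f : T -> \bar R) x : (forall y, 0 <= f y)%E ->
  (\esum_(y in D) ((K x y)%:E * f y) =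
   \sum_i ((wt x i)%:E * ((\1_D (mv x i))%:E * f (mv x i))))%E.
Proof.
move=> f0; rewrite esum_mkcond.
have -> : (\esum_(y in setT) (if y \in D then (K x y)%:E * f y else 0) =
  \esum_(y in setT) \sum_i if mv x i == y then
     (wt x i)%:E * ((\1_D (mv x i))%:E * f (mv x i)) else 0)%E.
  apply: eq_esum => y _; rewrite -big_mkcond /=.
  rewrite (eq_bigr (fun i => (wt x i)%:E * ((\1_D y)%:E * f y)))%E; last first.
    by move=> i /eqP ->.
  rewrite /K -sumEFin ge0_sume_distrl; last by move=> i _; rewrite lee_fin.
  case: ifPn => yD.
    by apply: eq_bigr => i _; rewrite indicE yD mul1e.
  by rewrite big1 // => i _; rewrite indicE (negPf yD) mul0e mule0.
have nn i : (0 <= (wt x i)%:E * ((\1_D (mv x i))%:E * f (mv x i)))%E.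
  by rewrite mule_ge0 ?lee_fin // mule_ge0 // lee_fin.
rewrite esum_sum; last by move=> y i _ _; case: ifP.
apply: eq_bigr => i _.
rewrite -[RHS](@esum_set1 _ _ (mv x i) (fun=> (wt x i)%:E *
  ((\1_D (mv x i))%:E * f (mv x i))))%E // [RHS]esum_mkcond.
apply: eq_esum => y _; rewrite eq_sym.
by congr (if _ then _ else _); apply/eqP/idP; rewrite inE.
Qed.

Lemma esum_branching_fin D (f : T -> R) x : (forall y, 0 <= f y) ->
  (\esum_(y in D) ((K x y)%:E * (f y)%:E) = (mean (fun y => \1_D y * f y) x)%:E)%E.
Proof.
move=> f0; rewrite esum_branching; last by move=> y; rewrite lee_fin.
by rewrite -sumEFin; apply: eq_bigr => i _; rewrite !EFinM.
Qed.

Lemma esum_branching1 D x :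
  (\esum_(y in D) (K x y)%:E = (mean \1_D x)%:E)%E.
Proof.
rewrite -(eq_mean (g := fun y => \1_D y * 1)); last by move=> *; rewrite mulr1.
rewrite -esum_branching_fin //; first by apply: eq_esum => y _; rewrite mule1.
Qed.

Fixpoint fp C n x : R :=
  if n is m.+1 then mean (fun y => \1_(~` C)%classic y * fp C m y) x
  else mean \1_C x.

Lemma fp_ge0 C n x : 0 <= fp C n x.
Proof.
elim: n x => [|n IH] x; apply: mean_ge0 => // i _.
by rewrite mulr_ge0.
Qed.

Lemma first_passageE C n x : first_passage K C n x = (fp C n x)%:E.
Proof.
elim: n x => [|n IH] x /=; first by rewrite esum_branching1.
rewrite -esum_branching_fin; last by move=> y; exact: fp_ge0.
by apply: eq_esum => y _; rewrite IH.
Qed.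

Lemma nstep_branching_ge0 n x y : (0 <= nstep K n x y)%E.
Proof.
elim: n x => [|n IH] x /=; first by rewrite lee_fin.
by apply: esum_ge0 => z _; rewrite mule_ge0 // lee_fin branching_kernel_ge0.
Qed.

Lemma nstep_succ_gt0 n x y : (0 < nstep K n.+1 x y)%E ->
  exists2 i, wt x i != 0 & (0 < nstep K n (mv x i) y)%E.
Proof.
move=> /= H; apply: contrapT => /forall2NP N; move: H.
rewrite esum_branching; last by move=> z; exact: nstep_branching_ge0.
rewrite big1 ?ltxx // => i _.
have [/negP|/negP] := N i.
  by rewrite negbK => /eqP ->; rewrite mul0e.
rewrite -leNgt => H0.
have -> : nstep K n (mv x i) y = 0%E.
  by apply/eqP; rewrite eq_le H0 nstep_branching_ge0.
by rewrite !mule0.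
Qed.

Lemma nstep_mv_gt0 n x i y : wt x i != 0 -> (0 < nstep K n (mv x i) y)%E ->
  (0 < nstep K n.+1 x y)%E.
Proof.
move=> w0 H /=; rewrite esum_branching; last first.
  by move=> z; exact: nstep_branching_ge0.
rewrite (bigD1 i) //=; apply: lt_le_trans (leeDl _ _); last first.
  apply: sume_ge0 => j _; rewrite mule_ge0 ?lee_fin // mule_ge0 ?lee_fin //.
  exact: nstep_branching_ge0.
rewrite indicT mul1e mule_gt0 // lte_fin lt_def w0 wt_ge0 //.
Qed.

Hypothesis wt1 : forall x, \sum_i wt x i = 1.

(** Since [fp C k] refers to passage at time k + 1, this is the probability of reaching C at some
    time in 1..n. *)
Definition fp_sum C n x : R := \sum_(k < n) fp C k x.

Lemma fp_sumS C n x :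
  fp_sum C n.+1 x = mean (fun y => \1_C y + \1_(~` C)%classic y * fp_sum C n y) x.
Proof.
rewrite /fp_sum big_ord_recl meanD; congr (_ + _).
rewrite -mean_sum; apply: eq_mean => i _; exact/esym/mulr_sumr.
Qed.

Lemma indic_split (C : set T) (c : R) y :
  (\1_C y + \1_(~` C)%classic y * c) = (if y \in C then 1 else c).
Proof.
rewrite !indicE in_setC; case: (y \in C) => /=; rewrite ?mul0r ?addr0 //.
by rewrite mul1r add0r.
Qed.

Lemma fp_sum_le1 C n x : fp_sum C n x <= 1.
Proof.
elim: n x => [|n IH] x; first by rewrite /fp_sum big_ord0.
rewrite fp_sumS -[leRHS](mean_cst mv 1 (wt1 x)) le_mean // => i _.
by rewrite indic_split; case: ifP.
Qed.

Lemma fp_sum_ge0 C n x : 0 <= fp_sum C n x.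
Proof. by apply: sumr_ge0 => k _; exact: fp_ge0. Qed.

Lemma fp_sum_nd C x : nondecreasing_seq (fp_sum C ^~ x).
Proof.
apply/nondecreasing_seqP => n; rewrite /fp_sum big_ord_recr /= lerDl.
exact: fp_ge0.
Qed.

Definition hit_prob C x : R := limn (fp_sum C ^~ x).

Lemma fp_sum_cvg C x : (fp_sum C ^~ x @ \oo --> hit_prob C x)%classic.
Proof.
apply: nondecreasing_is_cvgn; first exact: fp_sum_nd.
by exists 1 => _ [n _ <-]; exact: fp_sum_le1.
Qed.

Lemma fp_sum_le_hit C n x : fp_sum C n x <= hit_prob C x.
Proof.
by apply: nondecreasing_cvgn_le; [exact: fp_sum_nd|apply/cvg_ex; eexists; exact: fp_sum_cvg].
Qed.

Lemma hit_prob_ge0 C x : 0 <= hit_prob C x.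
Proof. exact: le_trans (fp_sum_ge0 C 0 x) (fp_sum_le_hit C 0 x). Qed.

Lemma hit_prob_le C x c : (forall n, fp_sum C n x <= c) -> hit_prob C x <= c.
Proof.
move=> H; apply: (cvgr_to_le (@fp_sum_cvg C x)); exact: nearW.
Qed.

Lemma hit_prob_le1 C x : hit_prob C x <= 1.
Proof. by apply: hit_prob_le => n; exact: fp_sum_le1. Qed.

Lemma passage_probE C x : passage_prob K C x = (hit_prob C x)%:E.
Proof.
rewrite /passage_prob; apply/cvg_lim => //.
have -> : (fun n => \sum_(0 <= k < n) first_passage K C k x)%E =
    EFin \o (fp_sum C ^~ x).
  apply/funext => n /=; rewrite /fp_sum -(big_mkord xpredT (fun k => fp C k x)).
  by rewrite -sumEFin; apply: eq_bigr => k _; rewrite first_passageE.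
by apply: cvg_EFin; [exact: nearW|exact: fp_sum_cvg].
Qed.

(** The first-step equation [fp_sumS] in the limit; the mean is a finite sum, so the limit is taken
    termwise. *)
Lemma hit_probE C x :
  hit_prob C x = mean (fun y => if y \in C then 1 else hit_prob C y) x.
Proof.
suff : (fp_sum C ^~ x @ \oo -->
    mean (fun y => if y \in C then 1 else hit_prob C y) x)%classic.
  by move/cvg_lim => <-.
rewrite -(cvg_shiftS (fp_sum C ^~ x)) /=.
rewrite (_ : (fun n => _) = (fun n =>
  mean (fun y => if y \in C then 1 else fp_sum C n y) x)); last first.
  apply/funext => n; rewrite fp_sumS.
  by apply: eq_mean => i _; rewrite indic_split.
rewrite /expect.
apply: cvg_big => [|i _]; first exact: add_continuous.
apply: cvgM; first exact: cvg_cst.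
by case: ifP => _; [exact: cvg_cst|exact: fp_sum_cvg].
Qed.

(** Optional stopping for a nonnegative supermartingale, obtained by induction on the horizon and
    passage to the limit. *)
Lemma hit_prob_min C phi m : 0 <= m -> (forall x, 0 <= phi x) ->
  (forall x, C x -> m <= phi x) -> (forall x, mean phi x <= phi x) ->
  forall x, m * hit_prob C x <= phi x.
Proof.
move=> m0 phi0 phiC sup x.
suff H n y : m * fp_sum C n y <= phi y.
  have cv : (m * fp_sum C n x @[n --> \oo] --> m * hit_prob C x)%classic.
    by apply: cvgMl_tmp; exact: fp_sum_cvg.
  by apply: (cvgr_to_le cv); exact: nearW.
elim: n y => [|n IH] y; first by rewrite /fp_sum big_ord0 mulr0.
apply: le_trans (sup y); rewrite fp_sumS -meanZ le_mean // => i _.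
rewrite indic_split; case: ifP => [|_]; last exact: IH.
by rewrite mulr1 => /set_mem/phiC.
Qed.

Lemma accessible_mv x i y : wt x i != 0 -> accessible K (mv x i) y ->
  accessible K x y.
Proof. by move=> w0 [n H]; exists n.+1; exact: nstep_mv_gt0 H. Qed.

Lemma accessible_refl x : accessible K x x.
Proof. by exists 0%N; rewrite /= eqxx lte_fin. Qed.

(** Minimum principle: at a state where phi takes its minimal value m, the nonnegative differences
    phi - m have mean at most 0, so phi equals m at every successor, and then along any path. *)
Lemma supermartingale_min phi m x y : (forall z, mean phi z <= phi z) ->
  (forall z, accessible K x z -> m <= phi z) ->
  phi x <= m -> accessible K x y -> phi y <= m.
Proof.
move=> sup + + [n]; elim: n x => [|n IH] x mx xm.
  by rewrite /= lte_fin ltr0n lt0b => /eqP <-.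
move=> /nstep_succ_gt0[i w0 Hi].
apply: (IH (mv x i)) => // [z iz|]; first exact: mx (accessible_mv w0 iz).
rewrite -subr_le0 -(pmulr_rle0 _ (_ : 0 < wt x i)) ?lt_def ?w0 ?wt_ge0 //.
have : mean (fun y => phi y - m) x <= 0.
  by rewrite meanB mean_cst // subr_le0 (le_trans (sup _)).
apply: le_trans; rewrite /expect (bigD1 i) //= lerDl; apply: sumr_ge0 => j _.
have [->|wj] := eqVneq (wt x j) 0; first by rewrite mul0r.
rewrite mulr_ge0 // subr_ge0 mx //.
exact: accessible_mv wj (accessible_refl _).
Qed.

(* If the chain is not unstable, it reaches [C] almost surely from everywhere
   and is recurrent there: a nonnegative supermartingale is then constant on [C]
   and bounded below by that constant. *)
Lemma unstable_of_supermartingale C phi v x :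
  irreducible_class K C -> C v ->
  (forall z, 0 <= phi z) -> (forall z, mean phi z <= phi z) ->
  1 <= phi v -> phi x < 1 -> unstable K C.
Proof.
move=> [_ Ccl Cacc] Cv phi0 sup phiv phix; apply: contrapT.
move=> /not_orP[/existsNP[x0 /not_implyP[Cx0 /negP]]].
rewrite -leNgt => rec /forallNP out.
(* [H] counts a visit at time 0 as well. As [x0] is recurrent, 1 - H is a supermartingale vanishing
   at [x0], and the minimum principle makes it vanish on C. *)
pose H y := if y \in [set x0]%classic then 1 else hit_prob [set x0]%classic y.
have mH z : mean H z = hit_prob [set x0]%classic z by rewrite -hit_probE.
have Hx0 : H x0 = 1 by rewrite /H mem_set.
have H1 z : H z <= 1 by rewrite /H; case: ifP => // _; exact: hit_prob_le1.
have rec1 : hit_prob [set x0]%classic x0 = 1.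
  by apply/eqP; rewrite eq_le hit_prob_le1 -lee_fin -passage_probE.
have HC y : C y -> H y = 1.
  move=> Cy; apply/eqP; rewrite eq_le H1 /= -subr_le0.
  apply: (@supermartingale_min (fun y => 1 - H y) 0 x0) => [z|z _||].
  - rewrite meanB mean_cst // mH lerB // /H; case: ifP => // /set_mem ->.
    by rewrite rec1.
  - by rewrite subr_ge0.
  - by rewrite Hx0 subrr.
  - exact: Cacc.
(* Since [x0] is hit almost surely from C, phi is minimal over C at [x0]; the minimum principle then
   gives phi v <= phi x0, so phi is at least 1 on C. *)
have phiC y : C y -> phi x0 <= phi y.
  move=> Cy; have [<-//|yx0] := eqVneq x0 y.
  have := HC _ Cy; rewrite /H memNset; last by move=> /= e; rewrite e eqxx in yx0.
  move=> h1; rewrite -(mulr1 (phi x0)) -h1.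
  by apply: hit_prob_min => // z ->.
have phix0 : 1 <= phi x0.
  apply: le_trans phiv _.
  apply: (@supermartingale_min phi _ x0) => // [z xz|]; last exact: Cacc.
  exact: phiC (Ccl _ _ Cx0 xz).
have {}phiC y : C y -> 1 <= phi y by move=> /phiC; exact: le_trans.
have Cx : ~ C x by move=> /phiC; rewrite leNgt phix.
case: (out x); split => //; rewrite ltNge; apply/negP.
rewrite passage_probE lee_fin => h1; move: phix; rewrite ltNge.
by rewrite (le_trans h1) // -[leLHS]mul1r hit_prob_min.
Qed.

Lemma stable_not_unstable (P : T -> T -> R) C :
  (exists x, C x) -> stable P C -> ~ unstable P C.
Proof.
move=> [x Cx] [rec out] [tr|[y [Cy]]].
  by have [e _] := rec _ Cx; have := tr _ Cx; rewrite /transient e ltxx.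
by have [e _] := out _ Cy; rewrite e ltxx.
Qed.

(* [(hitting probability of v) / (1 - return probability)] solves
   [g = 1_v + mean g]. *)
Lemma transient_green v : transient K v ->
  exists B : R, forall n x, \sum_(k < n) iter k mean \1_[set v]%classic x <= B.
Proof.
rewrite /transient passage_probE lte_fin => q1.
set q := hit_prob _ _ in q1.
pose g y := (if y \in [set v]%classic then 1 else hit_prob [set v]%classic y) / (1 - q).
have q0 : 0 < 1 - q by rewrite subr_gt0.
have mg x : \1_[set v]%classic x + mean g x = g x.
  rewrite /g (eq_mean (h := fun y => (1 - q)^-1 *
    if y \in [set v]%classic then 1 else hit_prob [set v]%classic y)); last first.
    by move=> *; rewrite mulrC.
  rewrite meanZ -hit_probE indicE.
  case: ifP => [/set_mem ->|_] /=; last by rewrite add0r mulrC.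
  by rewrite -/q mulrC; field; rewrite gt_eqF.
exists (1 - q)^-1 => n x; apply: (@le_trans _ _ (g x)); last first.
  rewrite /g ler_piMl ?invr_ge0 ?(ltW q0) //.
  by case: ifP => // _; exact: hit_prob_le1.
elim: n x => [|n IH] x.
  rewrite big_ord0 /g mulr_ge0 ?invr_ge0 ?(ltW q0) //.
  by case: ifP => // _; exact: hit_prob_ge0.
rewrite big_ord_recl -mg lerD2l.
by rewrite [leLHS](_ : _ = mean (fun y => \sum_(k < n) iter k mean \1_[set v]%classic y) x)
  ?le_mean // mean_sum.
Qed.


Lemma indicC_mul_le C (f g : T -> R) y : 0 <= g y -> (~ C y -> f y <= g y) ->
  \1_(~` C)%classic y * f y <= g y.
Proof.
move=> g0 fg; rewrite indicE in_setC; have [yC|yC] := boolP (y \in C); rewrite ?mul0r ?mul1r //.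
by apply: fg => /mem_set; rewrite (negPf yC).
Qed.

(** [S n] stands for a truncated expectation of the passage time. Outside C it is dominated by V, by
    induction on n; the bound takes one extra step because no drift is assumed at a start in C. *)
Lemma le_mean_passage_bound C V (S : nat -> T -> R) : (forall x, 0 <= V x) ->
  (forall x, ~ C x -> mean V x <= V x - 1) ->
  (forall x, S 0%N x <= 0) ->
  (forall n x, S n.+1 x <= 1 + mean (fun y => \1_(~` C)%classic y * S n y) x) ->
  forall n x, S n x <= 1 + mean V x.
Proof.
move=> V0 dV S0 SS.
have SV n x : ~ C x -> S n x <= V x.
  elim: n x => [|n IH] x Cx; first exact: le_trans (S0 x) (V0 x).
  apply: le_trans (SS n x) _; rewrite addrC -lerBrDr.
  apply: le_trans (dV _ Cx); apply: le_mean => // i _.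
  by apply: indicC_mul_le => // /IH.
have mV0 x : 0 <= mean V x by apply: mean_ge0.
case=> [|n] x; first by apply: le_trans (S0 x) _; rewrite addr_ge0.
apply: le_trans (SS n x) _; rewrite lerD2l; apply: le_mean => // i _.
by apply: indicC_mul_le => // /SV.
Qed.

Definition mp_sum C n x : R := \sum_(k < n) k.+1%:R * fp C k x.

(** The time k + 1 is split as 1 + k: the ones add up to [fp_sum], the rest is the passage time
    counted afresh after the first step. *)
Lemma mp_sumS C n x : mp_sum C n.+1 x =
  fp_sum C n.+1 x + mean (fun y => \1_(~` C)%classic y * mp_sum C n y) x.
Proof.
rewrite /mp_sum /fp_sum.
rewrite (eq_bigr (fun k : 'I_n.+1 => fp C k x + k%:R * fp C k x)); last first.
  by move=> k _; rewrite -natr1 mulrDl mul1r addrC.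
rewrite big_split /=; congr (_ + _); rewrite big_ord_recl mul0r add0r.
rewrite [RHS](eq_mean (h := fun y => \sum_(k < n)
   k.+1%:R * (\1_(~` C)%classic y * fp C k y))); last first.
  by move=> i _; rewrite mulr_sumr; apply: eq_bigr => k _; rewrite mulrCA.
by rewrite mean_sum; apply: eq_bigr => k _; rewrite meanZ.
Qed.

(* With [tau] the passage time, [1 - fp_sum C k] is [P (tau > k)], and these sum
   to [E tau], while [mp_sum C n] truncates [E tau]. *)
Lemma passage_of_drift C V : (forall x, 0 <= V x) ->
  (forall x, ~ C x -> mean V x <= V x - 1) ->
  forall x, passage_prob K C x = 1%E /\ (mean_passage K C x < +oo)%E.
Proof.
move=> V0 dV x; split; last first.
  apply: (@le_lt_trans _ _ (1 + mean V x)%:E); last exact: ltry.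
  rewrite /mean_passage; apply: lime_le.
    apply: is_cvg_nneseries => n _ _.
    by rewrite first_passageE -EFinM lee_fin mulr_ge0 // fp_ge0.
  apply: nearW => n.
  rewrite [leLHS](_ : _ = (mp_sum C n x)%:E); last first.
    rewrite /mp_sum -(big_mkord xpredT (fun k => k.+1%:R * fp C k x)) -sumEFin.
    by apply: eq_bigr => k _; rewrite first_passageE.
  rewrite lee_fin; apply: (le_mean_passage_bound V0 dV) => [y|m y].
    by rewrite /mp_sum big_ord0.
  by rewrite mp_sumS lerD2r fp_sum_le1.
have surv n y : 1 - fp_sum C n.+1 y =
    mean (fun z => \1_(~` C)%classic z * (1 - fp_sum C n z)) y.
  rewrite fp_sumS -{1}(mean_cst mv 1 (wt1 y)) -meanB; apply: eq_mean => i _.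
  rewrite !indicE in_setC; case: (_ \in C) => /=; ring.
have bd n : \sum_(k < n) (1 - fp_sum C k x) <= 1 + mean V x.
  apply: (le_mean_passage_bound V0 dV (S := fun n y => \sum_(k < n) (1 - fp_sum C k y))).
    by move=> y; rewrite big_ord0.
  move=> m y; rewrite big_ord_recl /= {1}/fp_sum big_ord0 subr0 lerD2l.
  under eq_bigr do rewrite surv.
  rewrite -mean_sum; apply: le_mean => // i _.
  by rewrite mulr_sumr.
rewrite passage_probE; congr EFin; apply/eqP; rewrite eq_le hit_prob_le1 /=.
(* If the passage probability fell short of 1 by e, each of the n survival probabilities would be at
   least e, and n e would stay below a bound independent of n. *)
rewrite leNgt; apply/negP => h1; set e := 1 - hit_prob C x.
have e0 : 0 < e by rewrite subr_gt0.
have nb n : n%:R * e <= 1 + mean V x.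
  apply: le_trans (bd n); rewrite mulr_natl -[n in _ *+ n]card_ord -sumr_const.
  by apply: ler_sum => k _; rewrite lerD2l lerN2 fp_sum_le_hit.
have := nb (Num.bound ((1 + mean V x) / e)).
rewrite leNgt -ltr_pdivrMr // => /negP; apply.
apply: archi_boundP; rewrite divr_ge0 ?(ltW e0) //.
by have := nb 0%N; rewrite mul0r.
Qed.

(* [N]-step probability of having met [v]: started from a point of the
   exceptional set it is positive for some [N], so a multiple of the sum of
   these functions absorbs the exceptional set in the drift condition. *)
Fixpoint meet v n x : R :=
  if x == v then 1 else if n is m.+1 then mean (meet v m) x else 0.

Lemma meet_itv v n x : 0 <= meet v n x <= 1.
Proof.
elim: n x => [|n IH] x /=; case: ifP => _; rewrite ?lexx ?ler01 //.
rewrite mean_ge0 //= => [|i _]; last by case/andP: (IH (mv x i)).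
rewrite -[leRHS](mean_cst mv 1 (wt1 x)) le_mean // => i _.
by case/andP: (IH (mv x i)).
Qed.

Lemma meet_nd v x : nondecreasing_seq (meet v ^~ x).
Proof.
apply/nondecreasing_seqP => n; elim: n x => [|n IH] x.
  by rewrite /= ; case: ifP => // _; apply: mean_ge0 => // i _; case: ifP.
rewrite [leLHS]/= [leRHS]/=; case: ifP => // _.
by apply: le_mean => // i _; exact: IH.
Qed.

Lemma meet_gt0 v x : accessible K x v -> exists n, 0 < meet v n x.
Proof.
move=> [n]; elim: n x => [|n IH] x.
  rewrite /= lte_fin ltr0n lt0b => xv; exists 0%N; by rewrite /= xv ltr01.
move=> /nstep_succ_gt0[i w0 /IH[m Hm]]; exists m.+1 => /=.
case: ifP => _; first exact: ltr01.
apply: lt_le_trans (mean_ge_term mv wt_ge0 x i _); last first.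
  by move=> y; case/andP: (meet_itv v m y).
by rewrite mulr_gt0 // lt_def w0 wt_ge0.
Qed.

Lemma foster_stable C (J : finType) (F : J -> T) V :
  semi_irreducible K C -> (forall x, 0 <= V x) ->
  (forall x, (forall j, x <> F j) -> mean V x <= V x - 1) ->
  stable K C.
Proof.
move=> [[[v0 Cv0] Ccl Cacc] _ acc] V0 dV.
have key v : C v -> exists2 V', (forall x, 0 <= V' x) &
    (forall x, x <> v -> mean V' x <= V' x - 1).
  move=> Cv.
  have /choice[N HN] : forall j, exists n, 0 < meet v n (F j).
    by move=> j; exact/meet_gt0/acc.
  pose M := (\max_j N j)%N.
  have Mgt0 j : 0 < meet v M (F j).
    by apply: lt_le_trans (HN j) _; apply: meet_nd; exact: leq_bigmax.
  (* M is a common horizon within which v is met with positive probability from every exceptional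
     state; b makes b times that probability at least mean V + 1 at each of them. *)
  pose b := \sum_j (`|mean V (F j)| + 1) / meet v M (F j).
  have b0 : 0 <= b by apply: sumr_ge0 => j _; rewrite divr_ge0 ?addr_ge0 // ltW.
  exists (fun x => V x + b * \sum_(k < M) (1 - meet v k x)) => x.
    rewrite addr_ge0 // mulr_ge0 // sumr_ge0 // => k _.
    by rewrite subr_ge0; case/andP: (meet_itv v k x).
  move=> /eqP xv; rewrite meanD meanZ mean_sum.
  (* Off v, one step turns [meet v k] into [meet v k.+1], so the sum telescopes; its other end
     [meet v 0 x] is 0. *)
  have -> : \sum_(k < M) mean (fun y => 1 - meet v k y) x =
            \sum_(k < M) (1 - meet v k x) - meet v M x.
    have -> : \sum_(k < M) mean (fun y => 1 - meet v k y) x =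
              \sum_(k < M) (1 - meet v k.+1 x).
      apply: eq_bigr => k _; rewrite meanB mean_cst //=.
      by rewrite (negPf xv).
    elim: (M) => [|m IH]; first by rewrite !big_ord0 /= (negPf xv) subr0.
    by rewrite !big_ord_recr IH /=; ring.
  have [[j xF]|/forallNP/dV dx] := pselect (exists j, x = F j); last first.
    have := meet_itv v M x; move: (meet v M x) => h /andP[h0 _].
    by have := mulr_ge0 b0 h0; lra.
  suff : mean V x + 1 <= b * meet v M x by have := V0 x; lra.
  rewrite xF -ler_pdivrMr // /b (bigD1 j) //=.
  apply: ler_wpDr.
    by apply: sumr_ge0 => k _; rewrite divr_ge0 ?addr_ge0 // ltW.
  by rewrite ler_wpM2r ?invr_ge0 ?(ltW (Mgt0 j)) // lerD2r ler_norm.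
split=> [x Cx|x Cx].
  have [V' V'0 dV'] := key x Cx.
  exact: (passage_of_drift V'0 (C := [set x]%classic)).
(* A drift outside the single state [v0] of C is in particular a drift outside C. *)
have [V' V'0 dV'] := key v0 Cv0.
apply: (passage_of_drift V'0 (C := C)) => y Cy; apply: dV' => e.
by apply: Cy; rewrite e.
Qed.

End FiniteBranching.

(** * Realisation on the unit interval *)

Section StepFunctions.
Context {R : realType}.
Implicit Types (f g : R -> R) (t : R * R * R).

(** A triple lists the left end, the right end and the height of a block; blocks are half-open so
    that adjacent ones share no point. *)
Definition step_fun (l : seq (R * R * R)) w : R :=
  \sum_(t <- l) t.2 * (t.1.1 <= w < t.1.2)%R%:R.

(** An explicit certificate that f is measurable, supported in [0, m] and of integral v. Keeping
    track of m lets functions be scaled and laid side by side. *)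
Definition is_step (m : R) f (v : R) : Prop :=
  exists l : seq (R * R * R),
    [/\ forall t, t \in l -> [/\ 0 <= t.1.1, t.1.1 <= t.1.2 & t.1.2 <= m],
        f = step_fun l & v = \sum_(t <- l) t.2 * (t.1.2 - t.1.1)].

Lemma is_step0 m : is_step m (fun=> 0) 0.
Proof.
exists [::]; split => //; last by rewrite big_nil.
by apply/funext => w; rewrite /step_fun big_nil.
Qed.

Lemma is_stepD m1 m2 f g v u : m1 <= m2 -> is_step m1 f v -> is_step m2 g u ->
  is_step m2 (fun w => f w + g w) (v + u).
Proof.
move=> m12 [l [lm -> ->]] [k [km -> ->]]; exists (l ++ k); split.
- move=> t; rewrite mem_cat => /orP[/lm[? ? tm]|/km//].
  by split => //; exact: le_trans tm m12.
- by apply/funext => w; rewrite /step_fun big_cat.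
- by rewrite big_cat.
Qed.

Lemma is_step_shift m p f v : 0 <= p -> is_step m f v ->
  is_step (p + m) (fun w => f (w - p)) v.
Proof.
move=> p0 [l [lm -> ->]]; exists [seq (t.1.1 + p, t.1.2 + p, t.2) | t <- l]; split.
- move=> _ /mapP[t /lm[t0 tt tm] ->] /=; split; first exact: addr_ge0.
    by rewrite lerD2r.
  by rewrite addrC lerD2l.
- apply/funext => w; rewrite /step_fun big_map; apply: eq_bigr => t _ /=.
  by rewrite lerBrDr ltrBlDr.
- by rewrite big_map; apply: eq_bigr => t _ /=; congr (_ * _); ring.
Qed.

Lemma is_step_dilate p f v : 0 < p -> is_step 1 f v ->
  is_step p (fun w => f (w / p)) (p * v).
Proof.
move=> p0 [l [lm -> ->]]; exists [seq (t.1.1 * p, t.1.2 * p, t.2) | t <- l]; split.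
- move=> _ /mapP[t /lm[t0 tt tm] ->] /=; split.
  + by rewrite mulr_ge0 // ltW.
  + by rewrite ler_pM2r.
  + by rewrite -[leRHS]mul1r ler_pM2r.
- apply/funext => w; rewrite /step_fun big_map; apply: eq_bigr => t _ /=.
  by rewrite ler_pdivlMr // ltr_pdivrMr.
- rewrite mulr_sumr big_map; apply: eq_bigr => t _ /=; ring.
Qed.

Lemma is_stepZ m c f v : is_step m f v -> is_step m (fun w => c * f w) (c * v).
Proof.
move=> [l [lm -> ->]]; exists [seq (t.1.1, t.1.2, c * t.2) | t <- l]; split.
- by move=> _ /mapP[t /lm[t0 tt tm] ->].
- apply/funext => w; rewrite /step_fun big_map mulr_sumr.
  by apply: eq_bigr => t _ /=; rewrite mulrA.
- by rewrite mulr_sumr big_map; apply: eq_bigr => t _ /=; rewrite mulrA.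
Qed.

Lemma is_step_itv (c : R) : is_step 1 (fun w => (0 <= w < 1)%R%:R * c) c.
Proof.
exists [:: (0, 1, c)]; split.
- by move=> t; rewrite inE => /eqP -> /=.
- by apply/funext => w; rewrite /step_fun big_seq1 mulrC.
- by rewrite big_seq1 /= subr0 mulr1.
Qed.

Let Pr : probability _ R := uniform_prob (@ltr01 R).

Lemma uniform_prob_itv (a b : R) : 0 <= a -> a <= b -> b <= 1 ->
  Pr `[a, b[%classic = (b - a)%:E.
Proof.
move=> a0 ab b1; rewrite [LHS](_ : _ =
  \int[lebesgue_measure]_(w in `[a, b[%classic) (uniform_pdf 0 1 w)%:E)%E //.
rewrite (eq_integral (fun=> 1%:E)); last first.
  move=> w; rewrite inE /= in_itv /= => /andP[aw wb].
  by rewrite /uniform_pdf subr0 invr1 (le_trans a0 aw) (le_trans (ltW wb) b1).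
rewrite integral_cst //= mul1e lebesgue_measure_itv /= lte_fin.
by move: ab; rewrite le_eqVlt => /orP[/eqP ->|->//]; rewrite ltxx subrr.
Qed.

Lemma step_measurable m f v : is_step m f v -> measurable_fun setT f.
Proof.
move=> [l [_ -> _]]; rewrite /step_fun.
apply: measurable_sum => t; apply: measurable_funM => //.
rewrite (_ : (fun w => _) = \1_(`[t.1.1, t.1.2[%classic : set R)) //.
by apply/funext => w; rewrite indicE mem_setE in_itv.
Qed.

Lemma step_integral f v : is_step 1 f v ->
  Pr.-integrable setT (EFin \o f) /\ (\int[Pr]_w (f w)%:E = v%:E)%E.
Proof.
move=> [l [lm -> ->]].
have ind t w : (t.1.1 <= w < t.1.2)%R%:R = \1_(`[t.1.1, t.1.2[%classic : set R) w :> R.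
  by rewrite indicE mem_setE in_itv.
elim: l lm => [|t l IH] lm.
  rewrite /step_fun; under eq_fun do rewrite big_nil.
  split; first exact: integrable0.
  by rewrite big_nil; under eq_integral do rewrite big_nil; rewrite integral0.
have [u ul|i1 e1] := IH; first by apply: lm; rewrite inE ul orbT.
have [t0 tt t1] := lm t (mem_head _ _).
have i0 : Pr.-integrable setT
    (fun w => t.2%:E * (\1_(`[t.1.1, t.1.2[%classic : set R) w)%:E)%E.
  by apply: integrableZl => //; exact: integrable_indic.
have Ef w : (step_fun (t :: l) w)%:E =
    (t.2%:E * (\1_(`[t.1.1, t.1.2[%classic : set R) w)%:E + (step_fun l w)%:E)%E.
  by rewrite /step_fun big_cons -EFinM -EFinD ind.
split.
  rewrite (_ : EFin \o _ = (fun w => t.2%:E * (\1_(`[t.1.1, t.1.2[%classic : set R) w)%:E + (step_fun l w)%:E)%E).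
    exact: integrableD.
  by apply/funext => w; rewrite /= Ef.
under eq_integral do rewrite Ef.
rewrite integralD // e1 integralZl //; last exact: integrable_indic.
rewrite integral_indic // setIT big_cons EFinD EFinM; congr (_ * _ + _)%E.
exact: uniform_prob_itv.
Qed.


Lemma uniform_prob_unit : Pr (~` `[0, 1[)%classic = 0%E.
Proof.
rewrite probability_setC //; have /= -> := uniform_prob_itv (lexx 0) ler01 (lexx 1).
by rewrite subr0 subee.
Qed.

Lemma step_prob (A : set R) v :
  is_step 1 (fun w => (0 <= w < 1)%R%:R * \1_A w) v ->
  measurable (A `&` `[0, 1[)%classic /\ Pr (A `&` `[0, 1[)%classic = v%:E.
Proof.
have -> : (fun w => (0 <= w < 1)%R%:R * \1_A w) =
    (\1_(A `&` `[0, 1[%classic)%classic : R -> R).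
  by apply/funext => w; rewrite indicI mulrC; congr (_ * _); rewrite indicE mem_setE in_itv.
move=> S; have /measurable_indicP mA := step_measurable S.
split; first exact: mA.
by have [_ <-] := step_integral S; rewrite integral_indic // setIT.
Qed.

(* One uniform variable [w] chooses [i] with probability [p i]; given the
   choice the rescaled remainder passed to [F i] is again uniform. *)
Fixpoint branch {X : Type} {I : Type} (p : I -> R) (F : I -> R -> X) (d : X)
    (s : seq I) (w : R) : X :=
  if s is i :: s' then
    if w < p i then F i (w / p i) else branch p F d s' (w - p i)
  else d.

Lemma branch_map (X Y I : Type) (h : X -> Y) p (F : I -> R -> X) d s w :
  h (branch p F d s w) = branch p (fun i u => h (F i u)) (h d) s w.
Proof. by elim: s w => //= i s IH w; case: ifP => // _; exact: IH. Qed.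

(** The graph is made of copies of the [F i], each compressed to width [p i], which multiplies its
    integral by [p i], and placed one after the other. *)
Lemma is_step_branch (I : Type) (p : I -> R) (F : I -> R -> R) d v (s : seq I) :
  (forall i, 0 <= p i) ->
  (forall i, is_step 1 (fun w => (0 <= w < 1)%R%:R * F i w) (v i)) ->
  is_step (\sum_(i <- s) p i)
    (fun w => (0 <= w < \sum_(i <- s) p i)%R%:R * branch p F d s w)
    (\sum_(i <- s) p i * v i).
Proof.
move=> p0 SF; elim: s => [|i s IH].
  rewrite !big_nil; rewrite (_ : (fun w => _) = fun=> 0); first exact: is_step0.
  by apply/funext => w; case: ltgtP; rewrite mul0r.
rewrite !big_cons; set r := \sum_(_ <- s) _ in IH *.
have r0 : 0 <= r by apply: sumr_ge0.
have S2 := is_step_shift (p0 i) IH.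
have S1 : is_step (p i) (fun w => (0 <= w < p i)%R%:R * F i (w / p i)) (p i * v i).
  (* A block of width 0 is empty, so the quotient by [p i] is never evaluated on it. *)
  have [pi0|pi0] := eqVneq (p i) 0.
    rewrite pi0 mul0r (_ : (fun w => _) = fun=> 0); first exact: is_step0.
    by apply/funext => w; case: ltgtP; rewrite mul0r.
  have {}pi0 : 0 < p i by rewrite lt_def pi0 p0.
  have := is_step_dilate pi0 (SF i); congr is_step.
  apply/funext => w; congr ((_ : bool)%:R * _).
  by rewrite ler_pdivlMr // mul0r ltr_pdivrMr // mul1r.
have := is_stepD _ S1 S2; rewrite lerDl => /(_ r0); congr is_step.
apply/funext => w /=; rewrite subr_ge0 ltrBlDl.
case: ltP => wp /=.
  rewrite (lt_le_trans wp) ?lerDl // !andbT.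
  by rewrite /= mul0r addr0.
by rewrite andbF mul0r add0r (le_trans (p0 i) wp).
Qed.

End StepFunctions.

(** * Trajectories driven by one uniform variable *)

Section Trajectory.
Context {R : realType} {T : choiceType} {I : finType}.
Variables (wt : T -> I -> R) (mv : T -> I -> T).
Hypothesis wt_ge0 : forall x i, 0 <= wt x i.
Hypothesis wt1 : forall x, \sum_i wt x i = 1.
Notation mean := (expect wt mv).
Notation K := (branching_kernel wt mv).
Implicit Types (x : T) (w : R) (y : nat -> T).

Fixpoint traj n x w : T :=
  if n is m.+1 then branch (wt x) (fun i => traj m (mv x i)) x (enum I) w else x.

Lemma is_step_onestep x (F : I -> R -> R) d v :
  (forall i, is_step 1 (fun w => (0 <= w < 1)%R%:R * F i w) (v i)) ->
  is_step 1 (fun w => (0 <= w < 1)%R%:R * branch (wt x) F d (enum I) w)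
    (\sum_i wt x i * v i).
Proof.
move=> SF; have := is_step_branch d (enum I) (wt_ge0 x) SF.
by rewrite !big_enum wt1.
Qed.

Lemma is_step_traj (g : T -> R) n x :
  is_step 1 (fun w => (0 <= w < 1)%R%:R * g (traj n x w)) (iter n mean g x).
Proof.
elim: n x => [|n IH] x; first exact: (is_step_itv (g x)).
have := is_step_onestep x (g x) (fun i => IH (mv x i)); congr is_step.
by apply/funext => w; rewrite /= (branch_map g).
Qed.

Fixpoint path_prob n y x : R :=
  (x == y 0%N)%:R *
  (if n is m.+1 then \sum_i wt x i * path_prob m (fun k => y k.+1) (mv x i) else 1).

Definition on_path n y x w : bool := [forall k : 'I_n.+1, traj k x w == y k].

(** The first branch chosen by w does not depend on n, so a whole trajectory, and not only one
    position, can be pulled out of [branch]; events on paths need this. *)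
Lemma trajS n x w : traj n.+1 x w =
  branch (wt x) (fun i u k => traj k (mv x i) u) (fun=> x) (enum I) w n.
Proof. by rewrite (branch_map (fun f => f n)). Qed.

Lemma is_step_on_path n y x :
  is_step 1 (fun w => (0 <= w < 1)%R%:R * (on_path n y x w)%:R) (path_prob n y x).
Proof.
elim: n y x => [|n IH] y x.
  rewrite [path_prob _ _ _]mulr1.
  rewrite (_ : (fun w => _) = fun w => (0 <= w < 1)%R%:R * (x == y 0%N)%:R).
    exact: is_step_itv.
  apply/funext => w; congr (_ * (_ : bool)%:R).
  by apply/forallP/idP => [/(_ ord0)//|e k]; rewrite (ord1 k).
have S := is_step_onestep x [forall k : 'I_n.+1, x == y k.+1]%:R (fun i => IH (fun k => y k.+1) (mv x i)).
have := is_stepZ (x == y 0%N)%:R S; congr is_step.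
apply/funext => w; rewrite mulrCA; congr (_ * _).
have -> : on_path n.+1 y x w =
    (x == y 0%N) && [forall k : 'I_n.+1, traj k.+1 x w == y k.+1].
  apply/forallP/andP => [H|[H0 /forallP H] k].
    split; first exact: (H ord0).
    by apply/forallP => k; exact: (H (lift ord0 k)).
  by case: (unliftP ord0 k) => [j|] -> //; exact: H.
rewrite -mulnb natrM; congr (_ * _).
pose h (f : nat -> T) : R := [forall k : 'I_n.+1, f k == y k.+1]%:R.
have -> : [forall k : 'I_n.+1, traj k.+1 x w == y k.+1]%:R =
    h (branch (wt x) (fun i u k => traj k (mv x i) u) (fun=> x) (enum I) w).
  by congr ((_ : bool)%:R); apply: eq_forallb => k; rewrite trajS.
by rewrite (branch_map h).
Qed.

Lemma path_probS n y x :
  path_prob n.+1 y x = path_prob n y x * K (y n) (y n.+1).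
Proof.
elim: n y x => [|n IH] y x; last first.
  rewrite [LHS]/= [in RHS]/= -mulrA; congr (_ * _); rewrite mulr_suml.
  by apply: eq_bigr => i _; rewrite -mulrA -IH.
rewrite /= !mulr1; have [->|_] := eqVneq x (y 0%N); last by rewrite !mul0r.
rewrite !mul1r /branching_kernel [RHS]big_mkcond; apply: eq_bigr => i _.
by rewrite mulr1; case: ifP => _; rewrite ?mulr1 ?mulr0.
Qed.

(* Constant outside the unit interval, which has measure one. *)
Definition chain x n (w : R) : T := if 0 <= w < 1 then traj n x w else x.

Lemma chain0 x w : chain x 0 w = x.
Proof. by rewrite /chain; case: ifP. Qed.

Let Pr : probability _ R := uniform_prob (@ltr01 R).

(** Outside [0, 1[ the chain is constant, so that part of the event is empty or the whole
    complement, and null in both cases. *)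
Lemma chain_event (A : set (nat -> T)) x v :
  is_step 1 (fun w => (0 <= w < 1)%R%:R * \1_[set u | A (fun n => traj n x u)]%classic w) v ->
  measurable [set w | A (chain x ^~ w)]%classic /\
  Pr [set w | A (chain x ^~ w)]%classic = v%:E.
Proof.
move=> /step_prob[mA pA].
pose B := [set w : R | A (fun=> x) /\ ~ (0 <= w < 1)]%classic.
have -> : [set w | A (chain x ^~ w)]%classic =
    (([set u | A (fun n => traj n x u)] `&` `[0, 1[) `|` B)%classic.
  rewrite /chain; apply/seteqP; split => w /=; rewrite in_itv /=.
    case w1: (0 <= w < 1) => Aw; [by left|right].
    by rewrite /B /= w1.
  by rewrite /B /=; case w1: (0 <= w < 1) => -[[Aw w2]|[Aw w2]].
have B0 : measurable B /\ Pr B = 0%E.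
  have [Ax|Ax] := pselect (A (fun=> x)); last first.
    by rewrite (_ : B = set0) //; apply/seteqP; split => w // [].
  rewrite (_ : B = ~` `[0, 1[)%classic.
    split; [exact: measurableC|exact: uniform_prob_unit].
  by apply/seteqP; split => w /=; rewrite in_itv => //= -[].
split; first by apply: measurableU => //; exact: B0.1.
by rewrite -pA measureU0 //; case: B0.
Qed.

Lemma chain_markov x : markov_chain Pr K (chain x).
Proof.
split=> [n y|n y].
  have := is_step_traj (\1_[set y]%classic) n x.
  by move=> /(chain_event (A := fun f => f n = y))[].
have E m : Pr [set w | forall k, (k <= m)%N -> chain x k w = y k]%classic =
    (path_prob m y x)%:E.
  suff : is_step 1 (fun w => (0 <= w < 1)%R%:R *
      \1_[set u | forall k, (k <= m)%N -> traj k x u = y k]%classic w) (path_prob m y x).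
    by move=> /(chain_event (A := fun f => forall k, (k <= m)%N -> f k = y k))[].
  have := is_step_on_path m y x; congr is_step.
  apply/funext => w; congr (_ * _); rewrite indicE; congr ((_ : bool)%:R).
  apply/forallP/idP; rewrite inE /=.
    by move=> H k km; apply/eqP; exact: (H (Ordinal (km : (k < m.+1)%N))).
  by move=> H k; apply/eqP/H; rewrite -ltnS ltn_ord.
by rewrite !E path_probS EFinM.
Qed.

Lemma chain_lip (g : T -> R) x n w :
  (forall z i, `|g (mv z i) - g z| <= 1) -> `|g (chain x n w) - g x| <= n%:R.
Proof.
move=> lip; rewrite /chain; case: ifP => _; last by rewrite subrr normr0.
elim: n x w => [|n IH] x w; first by rewrite subrr normr0.
rewrite /=; elim: (enum I) w => [|i s IHs] w /=; first by rewrite subrr normr0.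
case: ifP => _; last exact: IHs.
rewrite -natr1 -(subrKA (g (mv x i))) (le_trans (ler_normD _ _)) //.
by rewrite lerD.
Qed.

(** The quotients are bounded by 1, as g moves by at most 1 per step (for n = 0 the quotient is 0 by
    convention), so dominated convergence applies; their integrals are known from [is_step_traj]. *)
Lemma cvg_mean_of_cvg_ae (g : T -> R) (c : R) x :
  (forall z i, `|g (mv z i) - g z| <= 1) ->
  {ae Pr, forall w, (g (chain x n w) - g x) / n%:R @[n --> \oo] --> c}%classic ->
  ((iter n mean g x - g x) / n%:R @[n --> \oo] --> c)%classic.
Proof.
move=> lip ae.
have bd n w : `|(g (chain x n w) - g x) / n%:R| <= 1.
  have [->|n0] := eqVneq n 0%N; first by rewrite invr0 mulr0 normr0.
  rewrite normrM normfV normr_nat ler_pdivrMr ?ltr0n ?lt0n // mul1r.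
  exact: chain_lip.
have S n : is_step 1 (fun w => (g (chain x n w) - g x) / n%:R)
    ((iter n mean g x - g x) / n%:R).
  have S1 := is_step_traj g n x.
  have S2 := is_stepZ (-1) (is_step_itv (g x)).
  have := is_stepZ (n%:R^-1) (is_stepD (lexx 1) S1 S2); congr is_step.
    apply/funext => w; rewrite /chain.
    by case: ifP => _ /=; rewrite ?mul1r ?mul0r ?mulN1r ?subrr mulrC // mulr0 subrr.
  by rewrite mulN1r mulrC.
have [|||||_ _] := @dominated_convergence _ _ R Pr setT measurableT
   (fun n w => ((g (chain x n w) - g x) / n%:R)%:E) (fun=> c%:E) (fun=> 1%:E).
- by move=> n; apply/measurable_EFinP; exact: step_measurable (S n).
- exact: measurable_cst.
- have [N [mN N0 sub]] := ae; exists N; split => // w Hw; apply: sub => cw.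
  by apply: Hw => _; apply: cvg_EFin => //; exact: nearW.
- by apply: finite_measure_integrable_cst.
- by apply: aeW => w n _; rewrite abse_EFin lee_fin.
have -> : (\int[Pr]_w c%:E = c%:E)%E.
  by rewrite integral_cst //; have /= -> := probability_setT Pr; rewrite mule1.
rewrite (_ : (fun n => _) = EFin \o (fun n => (iter n mean g x - g x) / n%:R)).
  by move/fine_cvgP => -[].
by apply/funext => n; have [_ ->] := step_integral (S n).
Qed.

End Trajectory.

(** * The walk, the expanded and the induced chains on Z^d *)

Section ConcreteChain.
Context {R : realType} {d : nat} (L : mmrrw R d).
Notation pos := {ffun 'I_d -> int}.
Notation cstate := (pos * nat)%type.
Implicit Types (A B : {set 'I_d}) (x y : pos).

Definition pos_face A x : {set 'I_d} := A :|: finset (fun l => 0 < x l).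

Definition inside A x : bool := [forall l, (l \notin A) ==> (0 <= x l)].

Definition translate x (z : step d) : pos := [ffun l => x l + incr z l].

(** Numbering phases by plain naturals frees states from types depending on the face; numbers out of
    range get probability 0. *)
Definition jump_nat A B (z : step d) (i j : nat) : R :=
  if (insub i : option 'I_(phases L A)) is Some i' then
    if (insub j : option 'I_(phases L B)) is Some j' then
      @jump R d L A B z i' j' else 0 else 0.

Definition dom A (u : cstate) : bool := inside A u.1 && (u.2 < phases L (pos_face A u.1))%N.

(** A common bound on the phases gives every state the same finite type of moves. *)
Definition max_phases : nat := \max_(B : {set 'I_d}) phases L B.

Definition move_index : finType := (step d * 'I_max_phases)%type.

Definition cmv (u : cstate) (i : move_index) : cstate := (translate u.1 i.1, i.2 : nat).

(* In mode [set0] this is the walk and in mode [A] the expanded chain; the induced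
   chain is the action of mode [A] on functions not depending on x(A).  All
   weights vanish outside [dom A]. *)
Definition cwt A (u : cstate) (i : move_index) : R :=
  if dom A u && inside A (translate u.1 i.1) then
    jump_nat (pos_face A u.1) (pos_face A (translate u.1 i.1)) i.1 u.2 i.2
  else 0.

Lemma jump_natE A B z (i : 'I_(phases L A)) (j : 'I_(phases L B)) :
  jump_nat A B z i j = @jump R d L A B z i j.
Proof. by rewrite /jump_nat !valK. Qed.

Lemma incr_bound (z : step d) l : `|incr z l| <= 1.
Proof. by rewrite /incr; case: (z l) => -[|[|[|]]]. Qed.

Lemma translate_inj x : injective (translate x).
Proof.
move=> z z' /ffunP H; apply/ffunP => l; have := H l; rewrite !ffunE.
by move/addrI/addIr => [/val_inj].
Qed.

Lemma cwt_out A u i : ~~ dom A u -> cwt A u i = 0.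
Proof. by rewrite /cwt => /negPf ->. Qed.

Lemma cwt_neq0 A u i : cwt A u i != 0 -> dom A u && dom A (cmv u i).
Proof.
rewrite /cwt; case: ifP => [/andP[-> ins]|_]; last by rewrite eqxx.
rewrite /dom /= ins /= /jump_nat; case: insubP => [i' _ _|]; last by rewrite eqxx.
by case: insubP => [//|]; rewrite eqxx.
Qed.

(* Two modes look alike to one transition when no coordinate handled
   differently by them is within reach of the boundary. *)
Definition alike A B x y : bool :=
  [forall l, if l \in A then (l \in B) || (2 <= y l)
             else if l \in B then 2 <= x l else x l == y l].

Lemma alike_face A B x y : alike A B x y -> pos_face A x = pos_face B y.
Proof.
move=> /forallP H; apply/setP => l; have := H l; rewrite !inE.
case: (l \in A) => /=; first by case: (l \in B) => //= H2; apply/esym; lia.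
by case: (l \in B) => [H2|/eqP ->//]; lia.
Qed.

Lemma alike_face_translate A B x y z : alike A B x y ->
  pos_face A (translate x z) = pos_face B (translate y z).
Proof.
move=> /forallP H; apply/setP => l; have := H l; rewrite !inE !ffunE.
have := incr_bound z l; move: (incr z l) => k; rewrite ler_norml => /andP[k1 k2].
case: (l \in A) => /=; first by case: (l \in B) => //= H2; apply/esym; lia.
by case: (l \in B) => [H2|/eqP ->//]; lia.
Qed.

Lemma alike_inside A B x y : alike A B x y -> inside A x = inside B y.
Proof.
move=> /forallP H; apply: eq_forallb => l; have := H l.
case: (l \in A) => /=; first by case: (l \in B) => //= H2; apply/esym; lia.
by case: (l \in B) => [H2|/eqP ->//]; lia.
Qed.

Lemma alike_inside_translate A B x y z : alike A B x y ->
  inside A (translate x z) = inside B (translate y z).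
Proof.
move=> /forallP H; apply: eq_forallb => l; have := H l; rewrite !ffunE.
have := incr_bound z l; move: (incr z l) => k; rewrite ler_norml => /andP[k1 k2].
case: (l \in A) => /=; first by case: (l \in B) => //= H2; apply/esym; lia.
by case: (l \in B) => [H2|/eqP ->//]; lia.
Qed.

Lemma alike_dom A B x y j : alike A B x y -> dom A (x, j) = dom B (y, j).
Proof. by move=> H; rewrite /dom /= (alike_inside H) (alike_face H). Qed.

Lemma alike_cwt A B x y j i : alike A B x y -> cwt A (x, j) i = cwt B (y, j) i.
Proof.
move=> H; rewrite /cwt (alike_dom _ H) /= (alike_inside_translate _ H).
by rewrite (alike_face H) (alike_face_translate _ H).
Qed.

(* A chart identifies a chain with the concrete one, up to a projection
   [chart_proj] of positions (trivial for the walk and the expanded chains,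
   erasing the coordinates in A for the induced chains). *)
Record chart (T : choiceType) (K : T -> T -> R) A := Chart {
  emb : T -> cstate;
  chart_proj : pos -> pos;
  emb_inj : injective emb;
  emb_dom : forall v, dom A (emb v);
  emb_surj : forall c, dom A c -> exists v, emb v = (chart_proj c.1, c.2);
  pi_alike : forall x, alike A A x (chart_proj x);
  pi_translate : forall x z, chart_proj (translate (chart_proj x) z) = chart_proj (translate x z);
  chart_kernelE : forall t v, K t v =
    \sum_(z | chart_proj (translate (emb t).1 z) == (emb v).1)
      jump_nat (pos_face A (emb t).1) (pos_face A (emb v).1) z (emb t).2 (emb v).2
}.

Section Chart.
Context {T : choiceType} {K : T -> T -> R} {A : {set 'I_d}} (ch : chart K A).
Notation emb := (emb ch).
Notation chart_proj := (chart_proj ch).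

Definition chart_wt (u : T) (i : move_index) : R := cwt A (emb u) i.
(** The default [u] is reached only by moves leaving the domain, and these have weight 0. *)
Definition chart_mv (u : T) (i : move_index) : T :=
  xget u [set v | emb v = (chart_proj (cmv (emb u) i).1, (cmv (emb u) i).2)]%classic.

Lemma chart_mvE u i : dom A (cmv (emb u) i) ->
  emb (chart_mv u i) = (chart_proj (cmv (emb u) i).1, (cmv (emb u) i).2).
Proof.
move=> /(emb_surj ch)[v Hv]; rewrite /chart_mv.
by case: xgetP => [w -> //|/(_ v)].
Qed.

Lemma chart_kernel : K = branching_kernel chart_wt chart_mv.
Proof.
apply/funext => u; apply/funext => v; rewrite (chart_kernelE ch) /branching_kernel.
rewrite big_mkcond [RHS]big_mkcond /=.
rewrite -(pair_bigA _ (fun z j => if chart_mv u (z, j) == v then chart_wt u (z, j) else 0)) /=.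
apply: eq_bigr => z _; rewrite -big_mkcond /=.
case: ifP => [/eqP zv|zv]; last first.
  rewrite big1 // => j /eqP jv; apply/eqP; apply: contraFT zv => /cwt_neq0/andP[_].
  by move=> /chart_mvE; rewrite jv => ->.
have /andP[vin vph] := emb_dom ch v.
have jM : ((emb v).2 < max_phases)%N.
  by apply: leq_trans vph _; exact: leq_bigmax.
(* Once the increment leads to the position of v, the phase of v is the only index that leads to v
   itself. *)
rewrite (bigD1 (Ordinal jM)) /=; last first.
  apply/eqP/(@emb_inj _ _ _ ch); rewrite chart_mvE /=.
    by rewrite zv -surjective_pairing.
  rewrite /dom /= (alike_inside (pi_alike ch _)) (alike_face (pi_alike ch _)) zv.
  by rewrite vin.
rewrite big1 ?addr0; last first.
  move=> j /andP[/eqP jv]; apply: contraNeq => /cwt_neq0/andP[_ /chart_mvE].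
  by rewrite jv => e; apply/eqP/val_inj; rewrite /= e.
rewrite /chart_wt /cwt (emb_dom ch) /= (alike_inside (pi_alike ch _)) zv vin.
by rewrite (alike_face (pi_alike ch (translate _ _))) zv.
Qed.

Lemma chart_expect (h : cstate -> R) u : (forall x j, h (chart_proj x, j) = h (x, j)) ->
  expect chart_wt chart_mv (fun v => h (emb v)) u = expect (cwt A) cmv h (emb u).
Proof.
move=> hpi; apply: eq_bigr => i _; rewrite /chart_wt.
have [->|w0] := eqVneq (cwt A (emb u) i) 0; first by rewrite !mul0r.
have /andP[_ du] := cwt_neq0 w0.
by rewrite chart_mvE // hpi -surjective_pairing.
Qed.

Lemma expect_pi (h : cstate -> R) x j : (forall x j, h (chart_proj x, j) = h (x, j)) ->
  expect (cwt A) cmv h (chart_proj x, j) = expect (cwt A) cmv h (x, j).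
Proof.
move=> hpi; apply: eq_bigr => i _; rewrite (alike_cwt _ _ (pi_alike ch x)).
by rewrite /cmv /= -hpi pi_translate hpi.
Qed.

Lemma iter_pi (h : cstate -> R) n x j : (forall x j, h (chart_proj x, j) = h (x, j)) ->
  iter n (expect (cwt A) cmv) h (chart_proj x, j) = iter n (expect (cwt A) cmv) h (x, j).
Proof.
by move=> hpi; elim: n x j => [//|n IH] x j; rewrite !iterS expect_pi.
Qed.

Lemma chart_iter (h : cstate -> R) n u : (forall x j, h (chart_proj x, j) = h (x, j)) ->
  iter n (expect chart_wt chart_mv) (fun v => h (emb v)) u =
  iter n (expect (cwt A) cmv) h (emb u).
Proof.
move=> hpi; elim: n u => [//|n IH] u; rewrite !iterS -chart_expect.
  by apply: eq_mean => i _; exact: IH.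
by move=> x j; exact: iter_pi.
Qed.

End Chart.

Lemma tagged_ord_inj (X : Type) (m : X -> nat) (u v : {x : X & 'I_(m x)}) :
  tag u = tag v -> (tagged u : nat) = tagged v -> u = v.
Proof.
case: u v => [x i] [y j] /= xy; case: y / xy j => j ij.
by congr existT; exact: val_inj.
Qed.

Definition walk_emb (u : state L) : cstate :=
  ([ffun l => (tag u l)%:Z], tagged u : nat).

Lemma walk_emb_face u : pos_face finset.set0 (walk_emb u).1 = walk_face (tag u).
Proof. by apply/setP => l; rewrite !inE ffunE. Qed.

Lemma walk_emb_inj : injective walk_emb.
Proof.
move=> u v [/ffunP uv]; apply: tagged_ord_inj; apply/ffunP => l.
by have := uv l; rewrite !ffunE => -[].
Qed.

Lemma walk_emb_dom u : dom finset.set0 (walk_emb u).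
Proof.
rewrite /dom walk_emb_face ltn_ord andbT.
by apply/forallP => l; rewrite ffunE; apply/implyP.
Qed.

Lemma walk_emb_surj c : dom finset.set0 c -> exists v, walk_emb v = (c.1, c.2).
Proof.
case: c => x j /andP[/= /forallP x0 jx].
pose y : {ffun 'I_d -> nat} := [ffun l => `|x l|%N].
have xy l : (y l)%:Z = x l by have := x0 l; rewrite ffunE inE /=; lia.
have fy : walk_face y = pos_face finset.set0 x.
  by apply/setP => l; rewrite !inE -xy.
rewrite -fy in jx.
exists (existT (fun t : {ffun 'I_d -> nat} => 'I_(phases L (walk_face t))) y (Ordinal jx)).
by congr pair; apply/ffunP => l; rewrite ffunE xy.
Qed.

Lemma alike_refl A x : alike A A x x.
Proof. by apply/forallP => l; case: (l \in A). Qed.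

Lemma walk_kernelE u v : transition L u v =
  \sum_(z | translate (walk_emb u).1 z == (walk_emb v).1)
    jump_nat (pos_face finset.set0 (walk_emb u).1) (pos_face finset.set0 (walk_emb v).1) z
      (walk_emb u).2 (walk_emb v).2.
Proof.
rewrite !walk_emb_face; apply: eq_big => [z|z _]; last by rewrite jump_natE.
apply/forallP/eqP => [H|/ffunP H l].
  by apply/ffunP => l; rewrite !ffunE (eqP (H l)).
by have := H l; rewrite !ffunE => ->.
Qed.

Definition walk_chart : chart (transition L) finset.set0 :=
  @Chart _ _ _ walk_emb id walk_emb_inj walk_emb_dom walk_emb_surj
    (alike_refl finset.set0) (fun _ _ => erefl) walk_kernelE.

Section Expanded.
Variable A : {set 'I_d}.
Notation KA := (expanded_kernel (@jump R d L) (A := A)).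

Definition exp_emb (u : expanded_state (phases L) A) : cstate :=
  (sval (tag u), tagged u : nat).

Lemma exp_emb_inj : injective exp_emb.
Proof. by move=> u v [uv]; apply: tagged_ord_inj; apply: val_inj. Qed.

Lemma exp_emb_dom u : dom A (exp_emb u).
Proof. by rewrite /dom (ltn_ord (tagged u)) andbT; exact: (valP (tag u)). Qed.

Lemma exp_emb_surj c : dom A c -> exists v, exp_emb v = (c.1, c.2).
Proof.
case: c => x j /andP[/= x0 jx].
by exists (existT (fun y : expanded_pos A => 'I_(phases L (expanded_face y)))
  (exist _ x x0) (Ordinal jx)).
Qed.

Lemma exp_kernelE u v : KA u v =
  \sum_(z | translate (exp_emb u).1 z == (exp_emb v).1)
    jump_nat (pos_face A (exp_emb u).1) (pos_face A (exp_emb v).1) z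
      (exp_emb u).2 (exp_emb v).2.
Proof.
apply: eq_big => [z|z _]; last exact/esym/jump_natE.
apply/forallP/eqP => [H|/ffunP H l].
  by apply/ffunP => l; rewrite ffunE -[LHS](eqP (H l)).
by rewrite /expanded_coord -[X in X == _]H ffunE.
Qed.

Definition exp_chart : chart KA A :=
  @Chart _ _ _ exp_emb id exp_emb_inj exp_emb_dom exp_emb_surj
    (alike_refl A) (fun _ _ => erefl) exp_kernelE.

End Expanded.

Section Induced.
Variable A : {set 'I_d}.
Notation KA := (induced_kernel (@jump R d L) (A := A)).

Definition erase x : pos := [ffun l => if l \in A then 0 else x l].

Definition ind_emb (u : induced_state (phases L) A) : cstate :=
  ([ffun l => (sval (tag u) l)%:Z], tagged u : nat).

Lemma ind_emb_face u : pos_face A (ind_emb u).1 = induced_face (tag u).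
Proof. by apply/setP => l; rewrite !inE ffunE. Qed.

Lemma ind_emb_inj : injective ind_emb.
Proof.
move=> u v [/ffunP uv]; apply: tagged_ord_inj; apply/val_inj/ffunP => l.
by have := uv l; rewrite !ffunE => -[].
Qed.

Lemma ind_emb_dom u : dom A (ind_emb u).
Proof.
rewrite /dom ind_emb_face ltn_ord andbT.
by apply/forallP => l; rewrite ffunE; apply/implyP.
Qed.

Lemma erase_alike x : alike A A x (erase x).
Proof. by apply/forallP => l; rewrite ffunE; case: (l \in A) => /=. Qed.

Lemma erase_translate x z : erase (translate (erase x) z) = erase (translate x z).
Proof. by apply/ffunP => l; rewrite !ffunE; case: (l \in A). Qed.

Lemma ind_emb_erase u : erase (ind_emb u).1 = (ind_emb u).1.
Proof.
apply/ffunP => l; rewrite !ffunE; case: ifP => // lA.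
by have /forallP/(_ l) := valP (tag u); rewrite lA => /eqP ->.
Qed.

Lemma ind_emb_surj c : dom A c -> exists v, ind_emb v = (erase c.1, c.2).
Proof.
case: c => x j /andP[/= /forallP x0 jx].
pose y : {ffun 'I_d -> nat} := [ffun l => if l \in A then 0%N else `|x l|%N].
have y0 : [forall l, (l \in A) ==> (y l == 0%N)].
  by apply/forallP => l; rewrite ffunE; case: ifP.
have fy : induced_face (exist _ y y0 : induced_pos A) = pos_face A x.
  apply/setP => l; have := x0 l; rewrite !inE /= ffunE.
  by case: (l \in A) => //=; lia.
rewrite -fy in jx.
exists (existT (fun y : induced_pos A => 'I_(phases L (induced_face y)))
  (exist _ y y0) (Ordinal jx)).
congr pair; apply/ffunP => l; have := x0 l; rewrite !ffunE /=.
by case: (l \in A) => //=; lia.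
Qed.

Lemma ind_kernelE u v : KA u v =
  \sum_(z | erase (translate (ind_emb u).1 z) == (ind_emb v).1)
    jump_nat (pos_face A (ind_emb u).1) (pos_face A (ind_emb v).1) z
      (ind_emb u).2 (ind_emb v).2.
Proof.
rewrite !ind_emb_face; apply: eq_big => [z|z _]; last by rewrite jump_natE.
rewrite -(ind_emb_erase v).
apply/forallP/eqP => [H|/ffunP H l].
  by apply/ffunP => l; have := H l; rewrite !ffunE; case: (l \in A) => //= /eqP ->.
by apply/implyP => lA; have := H l; rewrite !ffunE (negPf lA) => ->.
Qed.

Definition ind_chart : chart KA A :=
  @Chart _ _ _ ind_emb erase ind_emb_inj ind_emb_dom ind_emb_surj
    erase_alike erase_translate ind_kernelE.

End Induced.

(** Distinct increments lead to distinct positions, so a nonzero weight is itself an entry of the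
    transition matrix. *)
Lemma walk_wt_ge0 u i : 0 <= chart_wt walk_chart u i.
Proof.
rewrite /chart_wt; have [->//|w0] := eqVneq (cwt finset.set0 (emb walk_chart u) i) 0.
have /andP[_ di] := cwt_neq0 w0; have ev := chart_mvE di.
have [+ _] := jump_stochastic L => /(_ u (chart_mv walk_chart u i)).
rewrite [X in _ <= X](chart_kernelE walk_chart) ev /= (big_pred1 i.1).
  by move: w0; rewrite /cwt; case: ifP => //; rewrite eqxx.
by move=> z; apply/eqP/eqP => [/translate_inj|->].
Qed.

(** Setting the coordinates in A to 2 gives a point where mode A and the walk look alike.
    Nonnegativity, and in the same way total mass 1, is thus inherited from the walk by every
    mode. *)
Lemma cwt_ge0 A c i : 0 <= cwt A c i.
Proof.
case: c => x j; pose y : pos := [ffun l => if l \in A then 2 else x l].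
have xy : alike A finset.set0 x y.
  by apply/forallP => l; rewrite ffunE inE; case: (l \in A) => //=.
rewrite (alike_cwt _ _ xy); have [d0|/cwt_out->//] := boolP (dom finset.set0 (y, j)).
have [u eu] := emb_surj walk_chart d0.
by rewrite -[(y, j)]eu; exact: walk_wt_ge0.
Qed.

Lemma cwt_sum1 A c : dom A c -> \sum_i cwt A c i = 1.
Proof.
case: c => x j; pose y : pos := [ffun l => if l \in A then 2 else x l].
have xy : alike A finset.set0 x y.
  by apply/forallP => l; rewrite ffunE inE; case: (l \in A) => //=.
rewrite (alike_dom _ xy) => d0.
rewrite (eq_bigr (cwt finset.set0 (y, j))); last by move=> i _; exact: alike_cwt.
have [u eu] := emb_surj walk_chart d0; rewrite -[(y, j)]eu.
have [_ /(_ u) H] := jump_stochastic L; apply: EFin_inj; rewrite -H.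
rewrite (eq_esum (b := fun v => (branching_kernel (chart_wt walk_chart)
    (chart_mv walk_chart) u v)%:E)); last by move=> v _; rewrite -chart_kernel.
rewrite (esum_branching1 _ walk_wt_ge0); congr EFin.
by apply: eq_bigr => i _; rewrite indicT mulr1.
Qed.

Section ChartStochastic.
Context {T : choiceType} {K : T -> T -> R} {A : {set 'I_d}} (ch : chart K A).

Lemma chart_wt_ge0 u i : 0 <= chart_wt ch u i.
Proof. exact: cwt_ge0. Qed.

Lemma chart_wt_sum1 u : \sum_i chart_wt ch u i = 1.
Proof. by rewrite /chart_wt cwt_sum1 // emb_dom. Qed.

End ChartStochastic.

Lemma drift_expect A (a : 'I_d -> R) c l : mean_drift L A a -> dom A c ->
  ((iter n (expect (cwt A) cmv) (fun c => (c.1 l)%:~R) c - (c.1 l)%:~R) / n%:R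
     @[n --> \oo] --> a l)%classic.
Proof.
move=> ma dc; have [u eu] := emb_surj (exp_chart A) dc.
have {}eu : emb (exp_chart A) u = c by rewrite eu; case: (c).
pose g (c : cstate) : R := (c.1 l)%:~R.
rewrite (_ : (fun n => _) = (fun n : nat =>
  (iter n (expect (chart_wt (exp_chart A)) (chart_mv (exp_chart A)))
     (fun v => g (emb (exp_chart A) v)) u - g (emb (exp_chart A) u)) / n%:R)); last first.
  by apply/funext => n; rewrite chart_iter // eu.
apply: cvg_mean_of_cvg_ae.
- exact: chart_wt_ge0.
- exact: chart_wt_sum1.
- move=> v i; rewrite /g -intrB -intr_norm -[leRHS]/(1%:~R) ler_int.
  rewrite /chart_mv; case: xgetP => [w _ ->|_] /=; last by rewrite subrr normr0.
  by rewrite ffunE addrC addKr incr_bound.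
have M := chain_markov (chart_mv (exp_chart A)) (chart_wt_ge0 (exp_chart A))
  (chart_wt_sum1 (exp_chart A)) u.
rewrite -chart_kernel in M.
have [N [mN N0 sub]] := ma _ _ _ _ M; exists N; split => // w Hw; apply: sub => cw.
apply: Hw; have := cw l; rewrite (_ : (fun n : nat => _) = (fun n : nat =>
 (g (emb (exp_chart A) (chain (chart_wt (exp_chart A)) (chart_mv (exp_chart A)) u n w)) -
  g (emb (exp_chart A) u)) / n%:R)) //.
apply/funext => n; by rewrite rmorphB /= chain0.
Qed.

End ConcreteChain.

(** * Correctors *)

Section Correctors.
Context {R : realType} {d : nat} (L : mmrrw R d).
Notation pos := {ffun 'I_d -> int}.
Notation cstate := (pos * nat)%type.
Notation dom := (dom L).
Notation E A := (expect (cwt (L := L) A) (@cmv R d L)).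
Implicit Types (A B : {set 'I_d}) (x y : pos) (c : cstate) (f g w : cstate -> R).

Lemma E_le A f g c :
  (forall i, dom A (@cmv _ _ L c i) -> f (cmv c i) <= g (cmv c i)) ->
  E A f c <= E A g c.
Proof.
move=> fg; apply: le_mean => [u i|i]; first exact: cwt_ge0.
by move=> /cwt_neq0/andP[_]; exact: fg.
Qed.

Lemma E_cst A k c : dom A c -> E A (fun=> k) c = k.
Proof. by move=> dc; apply: mean_cst; exact: cwt_sum1. Qed.

Lemma EB_le A f g c (b : R) : dom A c ->
  (forall i, dom A (@cmv _ _ L c i) -> f (cmv c i) <= g (cmv c i) + b) ->
  E A f c <= E A g c + b.
Proof.
move=> dc fg; rewrite -[X in _ <= _ + X](E_cst b dc) -meanD; exact: E_le.
Qed.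

Lemma iter_E_le A f g n c : (forall c, dom A c -> f c <= g c) -> dom A c ->
  iter n (E A) f c <= iter n (E A) g c.
Proof.
move=> fg; elim: n c => [|n IH] c dc; first exact: fg.
by apply: E_le => i di; exact: IH.
Qed.

Lemma E_alike A B g x j : alike A B x x -> E A g (x, j) = E B g (x, j).
Proof. by move=> H; apply: eq_bigr => i _; rewrite (alike_cwt _ _ H). Qed.

Definition lin (al : 'I_d -> R) c : R := \sum_k al k * (c.1 k)%:~R.

Definition lin_norm (al : 'I_d -> R) : R := \sum_k `|al k|.

Lemma lin_norm_ge0 al : 0 <= lin_norm al.
Proof. exact: sumr_ge0. Qed.

Lemma lin_cmvB al c i :
  lin al (@cmv _ _ L c i) - lin al c = \sum_k al k * (incr i.1 k)%:~R.
Proof.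
rewrite /lin -sumrB; apply: eq_bigr => k _.
by rewrite ffunE -mulrBr rmorphD /= addrC addKr.
Qed.

Lemma lin_cmv_bound al c i : `|lin al (@cmv _ _ L c i) - lin al c| <= lin_norm al.
Proof.
rewrite lin_cmvB (le_trans (ler_norm_sum _ _ _)) //; apply: ler_sum => k _.
rewrite normrM ler_piMr // -intr_norm -[leRHS]/(1%:~R) ler_int.
exact: incr_bound.
Qed.

Definition gain A f n c : R := iter n (E A) f c - f c.

Lemma gain0 A f c : gain A f 0 c = 0. Proof. exact: subrr. Qed.

Lemma gainS A f n c : gain A f n.+1 c = E A f c - f c + E A (gain A f n) c.
Proof. by rewrite /gain meanB iterS; ring. Qed.

Lemma gainSdom A f n c : dom A c -> gain A f n.+1 c =
  E A (fun c' => f c' - f c + gain A f n c') c.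
Proof. by move=> dc; rewrite gainS meanD meanB E_cst. Qed.

Lemma gain_bound A al n c : dom A c -> `|gain A (lin al) n c| <= n%:R * lin_norm al.
Proof.
elim: n c => [|n IH] c dc; first by rewrite gain0 normr0 mul0r.
have b i : dom A (@cmv _ _ L c i) ->
    `|lin al (cmv c i) - lin al c + gain A (lin al) n (cmv c i)| <= n.+1%:R * lin_norm al.
  move=> /IH H; rewrite (le_trans (ler_normD _ _)) // -natr1 mulrDl mul1r addrC.
  by rewrite lerD // lin_cmv_bound.
rewrite gainSdom // ler_norml -[X in X <= _](E_cst _ dc) -[X in _ && (_ <= X)](E_cst _ dc).
apply/andP; split; apply: E_le => i /b; rewrite ler_norml.
  by move=> /andP[].
by move=> /andP[].
Qed.

Definition agree_off A x y := forall k, k \notin A -> x k = y k.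

Lemma agree_alike A x y : agree_off A x y -> alike A A x y.
Proof.
by move=> H; apply/forallP => k; case: ifPn => [->//|kA]; rewrite (negPf kA) H.
Qed.

Lemma gain_agree A al n x y j : agree_off A x y -> dom A (x, j) ->
  gain A (lin al) n (x, j) = gain A (lin al) n (y, j).
Proof.
elim: n x y j => [|n IH] x y j xy dx; first by rewrite !gain0.
have Hxy := agree_alike xy.
have dy : dom A (y, j) by rewrite -(alike_dom L _ Hxy).
rewrite !gainSdom //; apply: eq_bigr => i _; rewrite -(alike_cwt _ _ Hxy).
have [->|/cwt_neq0/andP[_ di]] := eqVneq (cwt A (x, j) i) 0; first by rewrite !mul0r.
rewrite !lin_cmvB; congr (_ * (_ + _)); apply: IH => // k kA.
by rewrite !ffunE /= xy.
Qed.

(* A corrector turns a long-run drift into a one-step drift: the average of the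
   first [N] gains changes in one step by the [N]-step gain over [N], minus the
   one-step gain. *)
Lemma corrector_of_gain A al (e C : R) : 0 < e ->
  (forall n c, dom A c -> gain A (lin al) n c <= C - e * n%:R) ->
  exists w (W e' : R), [/\ 0 < e', forall c, `|w c| <= W,
    forall x y j, agree_off A x y -> w (x, j) = w (y, j) &
    forall c, dom A c -> E A (fun c => lin al c + w c) c <= lin al c + w c - e'].
Proof.
move=> e0 H; pose N := (Num.bound (`|C| / e)).+1.
(* N is so large that e N exceeds |C| + e, which makes every N-step gain at most -e. *)
have N0 : 0 < N%:R :> R by rewrite ltr0n.
have HN c : dom A c -> gain A (lin al) N c <= - e.
  move=> dc; apply: le_trans (H N c dc) _.
  have : `|C| / e < (Num.bound (`|C| / e))%:R.
    by apply: archi_boundP; rewrite divr_ge0 // ltW.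
  rewrite ltr_pdivrMr // /N -natr1 => h; have := ler_norm C; lra.
(* The value 0 outside the domain keeps w bounded everywhere. *)
pose w c := if dom A c then N%:R^-1 * \sum_(k < N) gain A (lin al) k c else 0.
have nn := lin_norm_ge0 al.
exists w, (N%:R * lin_norm al), (e / N%:R); split.
- exact: divr_gt0.
- move=> c; rewrite /w; case: ifP => dc; last by rewrite normr0 mulr_ge0 // ltW.
  rewrite normrM ger0_norm ?invr_ge0 ?(ltW N0) // mulrC ler_pdivrMr //.
  apply: le_trans (ler_norm_sum _ _ _) _.
  apply: (@le_trans _ _ (\sum_(k < N) (N%:R * lin_norm al))).
    apply: ler_sum => k _; apply: le_trans (gain_bound _ _ dc) _.
    by rewrite ler_wpM2r // ler_nat ltnW.
  by rewrite sumr_const card_ord mulr_natr.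
- move=> x y j xy; rewrite /w (alike_dom L _ (agree_alike xy)); case: ifP => // dc.
  congr (_ * _); apply: eq_bigr => k _; apply: gain_agree => //.
  by rewrite (alike_dom L _ (agree_alike xy)).
- move=> c dc; rewrite meanD.
  have -> : E A w c = w c + N%:R^-1 * gain A (lin al) N c - (E A (lin al) c - lin al c).
    have -> : E A w c = E A (fun c => N%:R^-1 * \sum_(k < N) gain A (lin al) k c) c.
      by apply: eq_mean => i /cwt_neq0/andP[_ di]; rewrite /w di.
    rewrite meanZ mean_sum.
    have -> : \sum_(k < N) E A (gain A (lin al) k) c =
      \sum_(k < N) gain A (lin al) k.+1 c - N%:R * (E A (lin al) c - lin al c).
      rewrite mulr_natl -[X in _ *+ X](card_ord N) -sumr_const -sumrB.
      by apply: eq_bigr => k _; rewrite gainS; ring.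
    have -> : \sum_(k < N) gain A (lin al) k.+1 c =
      \sum_(k < N) gain A (lin al) k c + gain A (lin al) N c.
      elim: (N) => [|m IH]; first by rewrite !big_ord0 gain0 addr0.
      by rewrite !big_ord_recr IH.
    by rewrite /w dc; field; rewrite gt_eqF.
  have := HN c dc; rewrite -(ler_pM2l (x := N%:R^-1)) ?invr_gt0 //.
  by rewrite mulrN [_^-1 * e]mulrC; lra.
Qed.

(** From height 2 on, one step cannot reach 0, so an interior state does not feel the reflection.
    For the full index set both predicates hold everywhere. *)
Definition near_boundary A x : bool := [forall k, (k \notin A) ==> (x k <= 1)].
Definition interior A x : bool := [forall k, (k \notin A) ==> (2 <= x k)].

Lemma interior_alike A x : interior A x -> alike A [set: 'I_d]%SET x x.
Proof.
move=> /forallP H; apply/forallP => k; rewrite inE; have := H k.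
by case: (k \in A).
Qed.

Lemma gain_lin_cvg A (a : 'I_d -> R) al c : mean_drift L A a -> dom A c ->
  (gain A (lin al) n c / n%:R @[n --> \oo] --> \sum_k al k * a k)%classic.
Proof.
move=> ma dc.
rewrite (_ : (fun n : nat => _) = (fun n : nat => \sum_k al k *
  ((iter n (E A) (fun c => (c.1 k)%:~R) c - (c.1 k)%:~R) / n%:R))).
  apply: cvg_big => [|k _]; first exact: add_continuous.
  by apply: cvgMl_tmp; exact: drift_expect.
apply/funext => n; rewrite /gain.
have -> : iter n (E A) (lin al) c = \sum_k al k * iter n (E A) (fun c => (c.1 k)%:~R) c.
  elim: n c dc => [//|n IH] c dc; rewrite iterS.
  rewrite (eq_mean (h := fun c' => \sum_k al k * iter n (E A) (fun c => (c.1 k)%:~R) c')).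
    by rewrite mean_sum; apply: eq_bigr => k _; rewrite meanZ.
  by move=> i /cwt_neq0/andP[_]; exact: IH.
rewrite /lin -sumrB mulr_suml; apply: eq_bigr => k _.
by rewrite -mulrBr mulrA.
Qed.

(** From each state the gain eventually has slope below e, half the limit in absolute value with
    negative sign, that is, it is at most -e n. Finitely many representatives near the boundary
    share one threshold N, and C = N (norm + e) pays for the times before N. *)
Lemma near_gain A (a : 'I_d -> R) al : mean_drift L A a ->
  \sum_k al k * a k < 0 -> exists e C : R, [/\ 0 < e, 0 <= C &
    forall n c, dom A c -> near_boundary A c.1 -> gain A (lin al) n c <= C - e * n%:R].
Proof.
move=> ma; set s := \sum_k _ => s0.
pose e := - s / 2; have e0 : 0 < e by rewrite /e; lra.
pose J : finType := ({ffun 'I_d -> 'I_2} * 'I_(max_phases L))%type.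
pose rep (t : J) : cstate := ([ffun k => if k \in A then 0 else (t.1 k)%:Z], t.2 : nat).
have /choice[n0 Hn0] : forall t : J, exists n0, forall n, (n0 <= n)%N ->
    dom A (rep t) -> gain A (lin al) n (rep t) <= - e * n%:R.
  move=> t; have [dt|_] := boolP (dom A (rep t)); last by exists 0%N.
  have cv := gain_lin_cvg (al := al) ma dt.
  have /(cvgr_lt _ cv) : \sum_k al k * a k < - e by rewrite /e -/s; lra.
  move=> [n1 _ Hn1]; exists n1.+1 => n nn _; have n0 : 0 < n%:R :> R.
    by rewrite ltr0n (leq_trans _ nn).
  by rewrite -ler_pdivrMr // ltW // Hn1 //= ltnW.
pose N := (\max_t n0 t)%N.
have nn := lin_norm_ge0 al.
exists e, (N%:R * (lin_norm al + e)); split => //.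
  by rewrite mulr_ge0 // addr_ge0 // ltW.
move=> n [x j] dc /forallP /= nx.
have [Nn|nN] := leqP N n; last first.
  have := gain_bound al n dc; rewrite ler_norml => /andP[_ h].
  have : n%:R <= N%:R :> R by rewrite ler_nat ltnW.
  move=> h2; have : n%:R * (lin_norm al + e) <= N%:R * (lin_norm al + e).
    by rewrite ler_wpM2r // addr_ge0 // ltW.
  by lra.
have /andP[/forallP /= x0 jx] := dc.
have jM : (j < max_phases L)%N by apply: leq_trans jx _; exact: leq_bigmax.
pose t : J := ([ffun k => inord `|x k|%N], Ordinal jM).
have xt : agree_off A x (rep t).1.
  move=> k kA; rewrite /rep /t /= !ffunE (negPf kA).
  have := nx k; have := x0 k; rewrite kA /= => h1 h2.
  by rewrite inordK; lia.
rewrite (gain_agree al n xt dc).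
have dt : dom A (rep t) by rewrite -(alike_dom L j (agree_alike xt)).
apply: (@le_trans _ _ (- e * n%:R)).
  by apply: Hn0 => //; apply: leq_trans Nn; exact: leq_bigmax.
by rewrite mulNr lerDr mulr_ge0 // addr_ge0 // ltW.
Qed.

Lemma interior_drift A (w : cstate -> R) al (e : R) c :
  (forall c, dom [set: 'I_d]%SET c ->
     E [set: 'I_d]%SET (fun c => lin al c + w c) c <= lin al c + w c - e) ->
  dom A c -> interior A c.1 ->
  E A (fun c => lin al c + w c) c <= lin al c + w c - e.
Proof.
case: c => x j H dc /interior_alike al_x; rewrite (E_alike _ _ al_x).
by apply: H; rewrite -(alike_dom L _ al_x).
Qed.

(** With no reflection at all every state counts as near the boundary, so [near_gain] is uniform.
    The drift it yields carries over to the interior states of all modes. *)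
Lemma full_corrector (a : 'I_d -> R) al :
  mean_drift L [set: 'I_d]%SET a -> \sum_k al k * a k < 0 ->
  exists w (W e : R), [/\ 0 < e, 0 <= W, forall c, `|w c| <= W,
    forall x y j, w (x, j) = w (y, j) &
    forall A c, dom A c -> interior A c.1 ->
      E A (fun c => lin al c + w c) c <= lin al c + w c - e].
Proof.
move=> ma aneg; have [e [C [e0 C0 H]]] := near_gain ma aneg.
have {}H n c : dom [set: 'I_d]%SET c ->
    gain [set: 'I_d]%SET (lin al) n c <= C - e * n%:R.
  by move=> dc; apply: H => //; apply/forallP => k; rewrite inE.
have [w [W [e' [e'0 wW winv wE]]]] := corrector_of_gain e0 H.
exists w, W, e'; split => //.
- exact: le_trans (normr_ge0 _) (wW (0, 0%N)).
- by move=> x y j; apply: winv => k; rewrite inE.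
- by move=> A c dc; exact: (interior_drift wE).
Qed.

Definition one_free A := forall k k', k \notin A -> k' \notin A -> k = k'.

Lemma near_or_interior A c : one_free A -> dom A c -> near_boundary A c.1 \/ interior A c.1.
Proof.
move=> A1 _; have [|nx] := boolP (near_boundary A c.1); first by left.
right; apply/forallP => k; apply/implyP => kA.
move: nx; rewrite negb_forall => /existsP[k']; rewrite negb_imply => /andP[k'A].
by rewrite (A1 k k') //; lia.
Qed.

(** Induction on n with w carried along: an interior state takes one step with drift -e1, and a
    state near the boundary is settled at once by its own gain bound. *)
Lemma stable_gain A (w : cstate -> R) (W : R) al (e1 e2 C : R) :
  one_free A -> 0 < e1 -> 0 < e2 -> (forall c, `|w c| <= W) ->
  (forall c, dom A c -> interior A c.1 ->
     E A (fun c => lin al c + w c) c <= lin al c + w c - e1) ->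
  (forall n c, dom A c -> near_boundary A c.1 -> gain A (lin al) n c <= C - e2 * n%:R) ->
  exists2 e : R, 0 < e & exists C' : R, forall n c, dom A c ->
    gain A (lin al) n c <= C' - e * n%:R.
Proof.
move=> A1 e10 e20 wW Hi Hn; pose e := Num.min e1 e2.
have e0 : 0 < e by rewrite lt_min e10.
have W0 : 0 <= W by apply: le_trans (normr_ge0 _) (wW (0, 0%N)).
exists e => //; exists (`|C| + W + W) => n c dc.
suff : gain A (lin al) n c <= `|C| + W + w c - e * n%:R.
  by have := wW c; rewrite ler_norml => /andP[_]; lra.
elim: n c dc => [|n IH] c dc.
  rewrite gain0 mulr0 subr0; have := wW c; rewrite ler_norml => /andP[h _].
  have := normr_ge0 C; lra.
have [nc|ic] := near_or_interior A1 dc.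
  apply: le_trans (Hn _ _ dc nc) _; have := wW c; rewrite ler_norml => /andP[h _].
  have : e * n.+1%:R <= e2 * n.+1%:R by rewrite ler_wpM2r // ge_min lexx orbT.
  have := ler_norm C; lra.
rewrite gainSdom //.
apply: (@le_trans _ _ (E A (fun c => lin al c + w c) c + (`|C| + W - lin al c - e * n%:R))).
  apply: EB_le => // i di; have := IH _ di; lra.
have := Hi c dc ic.
have : e <= e1 by rewrite ge_min lexx.
rewrite -natr1; lra.
Qed.

(** Modulo x(A) the states near the boundary are finitely many states of the induced chain, and each
    has a Green function bounded uniformly in the start. *)
Lemma near_green A : induced_transient L A ->
  exists G : R, forall n c, dom A c ->
    \sum_(k < n) iter k (E A) (fun c => (near_boundary A c.1)%:R) c <= G.
Proof.
move=> tr; pose ch := ind_chart L A.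
have d0 : dom A (0, 0%N).
  apply/andP; split; last exact: phases_gt0.
  by apply/forallP => k; rewrite ffunE lexx implybT.
have [u0 _] := emb_surj ch d0.
pose J : finType := ({ffun 'I_d -> 'I_2} * 'I_(max_phases L))%type.
pose rep (t : J) : induced_state (phases L) A := xget u0
  [set v | emb ch v = ([ffun k => if k \in A then 0 else (t.1 k)%:Z], t.2 : nat)]%classic.
have /choice[G HG] : forall t : J, exists G, forall n u,
    \sum_(k < n) iter k (expect (chart_wt ch) (chart_mv ch)) \1_[set rep t]%classic u <= G.
  move=> t; apply: transient_green; [exact: chart_wt_ge0|exact: chart_wt_sum1|].
  by rewrite -chart_kernel; exact: tr.
exists (\sum_t G t) => n c dc; have [u eu] := emb_surj ch dc.
pose h c : R := (near_boundary A c.1)%:R.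
have hpi x j : h (chart_proj ch x, j) = h (x, j).
  rewrite /h /near_boundary /=; congr ((_ : bool)%:R); apply: eq_forallb => k.
  by rewrite /= ffunE; case: (k \in A).
have -> : \sum_(k < n) iter k (E A) h c =
    \sum_(k < n) iter k (expect (chart_wt ch) (chart_mv ch)) (fun v => h (emb ch v)) u.
  by apply: eq_bigr => k _; rewrite chart_iter // eu iter_pi // -surjective_pairing.
have hle k v : iter k (expect (chart_wt ch) (chart_mv ch)) (fun v => h (emb ch v)) v <=
    \sum_t iter k (expect (chart_wt ch) (chart_mv ch)) \1_[set rep t]%classic v.
  elim: k v => [|k IH] v.
    rewrite /= /h; have [nv|_] := boolP (near_boundary A _); last exact: sumr_ge0.
    have dv := emb_dom ch v; have /andP[/forallP /= v0 vj] := dv.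
    have vM : ((emb ch v).2 < max_phases L)%N.
      by apply: leq_trans vj _; exact: leq_bigmax.
    pose t : J := ([ffun k => inord `|(emb ch v).1 k|%N], Ordinal vM).
    have ev : emb ch v = ([ffun k => if k \in A then 0 else (t.1 k)%:Z], t.2 : nat).
      rewrite [LHS]surjective_pairing; congr pair; apply/ffunP => k.
      rewrite -[in LHS](ind_emb_erase v) !ffunE /=; case: ifPn => // kA.
      have := v0 k; have /forallP/(_ k) := nv; rewrite kA /= ffunE => h1 h2.
      by rewrite inordK; lia.
    have -> : v = rep t.
      rewrite /rep; case: xgetP => [v' _ /= ev'|/(_ v)//].
      by apply: (@emb_inj _ _ _ _ _ _ ch); exact: etrans ev (esym ev').
    rewrite (bigD1 t) //= indicE mem_set // lerDl; exact: sumr_ge0.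
  rewrite iterS; apply: (@le_trans _ _ (expect (chart_wt ch) (chart_mv ch)
    (fun v => \sum_t iter k (expect (chart_wt ch) (chart_mv ch)) \1_[set rep t]%classic v) v)).
    by apply: le_mean => [? ?|i _]; [exact: chart_wt_ge0|exact: IH].
  by rewrite mean_sum.
apply: (@le_trans _ _ (\sum_(k < n) \sum_t
    iter k (expect (chart_wt ch) (chart_mv ch)) \1_[set rep t]%classic u)).
  by apply: ler_sum => k _; exact: hle.
by rewrite exchange_big; apply: ler_sum => t _; exact: HG.
Qed.

(** The drift -e can fail only near the boundary, where the mean number of visits is bounded; the
    total loss is then bounded independently of n. *)
Lemma transient_gain A (w : cstate -> R) (W : R) al (e : R) :
  one_free A -> 0 < e -> (forall c, `|w c| <= W) ->
  (forall c, dom A c -> interior A c.1 ->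
     E A (fun c => lin al c + w c) c <= lin al c + w c - e) ->
  induced_transient L A ->
  exists C : R, forall n c, dom A c -> gain A (lin al) n c <= C - e * n%:R.
Proof.
move=> A1 e0 wW Hi tr; have [G HG] := near_green tr.
have W0 : 0 <= W by apply: le_trans (normr_ge0 _) (wW (0, 0%N)).
pose F c := lin al c + w c.
pose h c : R := (near_boundary A c.1)%:R.
(* One step changes F by at most [lin_norm al + W + W]; the last e makes up for the missing
   drift. *)
pose b := lin_norm al + W + W + e.
have b0 : 0 <= b by have := lin_norm_ge0 al; rewrite /b; lra.
have EF c : dom A c -> E A F c <= F c - e + b * h c.
  move=> dc; have [nc|ic] := near_or_interior A1 dc; last first.
    by apply: le_trans (Hi c dc ic) _; rewrite lerDl mulr_ge0 // /h ler0n.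
  rewrite /h nc mulr1 -[X in _ <= X](E_cst _ dc); apply: E_le => i _.
  have := lin_cmv_bound al c i; rewrite ler_norml => /andP[_].
  have := wW c; rewrite ler_norml => /andP[+ _].
  have := wW (cmv c i); rewrite ler_norml => /andP[_].
  rewrite /F /b; lra.
have it n c : dom A c -> iter n (E A) (lin al) c <=
    W + F c - e * n%:R + b * \sum_(k < n) iter k (E A) h c.
  elim: n c => [|n IH] c dc.
    rewrite /= mulr0 big_ord0 /F; have := wW c; rewrite ler_norml => /andP[+ _]; lra.
  rewrite iterS; apply: (@le_trans _ _ (E A (fun c => (F c + b * \sum_(k < n) iter k (E A) h c)
     + (W - e * n%:R)) c)).
    apply: E_le => i /IH; lra.
  rewrite meanD E_cst // meanD meanZ mean_sum big_ord_recl /=.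
  have := EF c dc; rewrite -natr1; lra.
exists (W + W + b * G) => n c dc; have := it n c dc.
have : b * (\sum_(k < n) iter k (E A) h c) <= b * G by rewrite ler_wpM2l // HG.
have := wW c; rewrite ler_norml => /andP[_]; rewrite /gain /F; lra.
Qed.

End Correctors.

(** * Drift criteria *)

Section DriftCriteria.
Context {R : realType} {d : nat} (L : mmrrw R d).
Notation pos := {ffun 'I_d -> int}.
Notation cstate := (pos * nat)%type.
Notation dom := (dom L).
Notation E A := (expect (cwt (L := L) A) (@cmv R d L)).
Notation gain := (gain L).
Implicit Types (A B : {set 'I_d}) (x y : pos) (c : cstate) (f g w : cstate -> R).

Lemma archi_absurd (C e : R) : 0 < e -> ~ (forall n : nat, e * n%:R <= C).
Proof.
move=> e0 H; have C0 : 0 <= C by have := H 0%N; rewrite mulr0.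
have := H (Num.bound (C / e)); rewrite leNgt => /negP; apply.
by rewrite mulrC -ltr_pdivrMr // archi_boundP // divr_ge0 // ltW.
Qed.

(** From exp(-y) >= 1 - y and (1 - y)(1 + y + 2 y^2) = 1 + y^2 (1 - 2 y) >= 1. *)
Lemma expR_le_quad (y : R) : `|y| <= 1 / 2 -> expR y <= 1 + y + 2 * y ^+ 2.
Proof.
rewrite ler_norml => /andP[y1 y2].
have H := expR_ge1Dx (- y); have e0 := expR_gt0 (- y).
rewrite -[y in expR y]opprK expRN -(ler_pM2l e0) divff ?gt_eqF //.
have q0 : 0 <= 1 + y + 2 * y ^+ 2 by nra.
apply: (@le_trans _ _ ((1 - y) * (1 + y + 2 * y ^+ 2))); first by nra.
by rewrite ler_wpM2r.
Qed.

(** In the second-order expansion the gain th e of the linear term outweighs the quadratic error 2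
    th^2 B^2. *)
Lemma exp_supermartingale A g c (B e th : R) : dom A c ->
  (forall i, `|g (@cmv _ _ L c i) - g c| <= B) -> E A g c <= g c - e ->
  0 <= th -> th * B <= 1 / 2 -> 2 * th * B ^+ 2 <= e ->
  E A (fun c => expR (th * g c)) c <= expR (th * g c).
Proof.
move=> dc gB Eg th0 thB thB2.
have -> : E A (fun c => expR (th * g c)) c =
    expR (th * g c) * E A (fun c' => expR (th * (g c' - g c))) c.
  rewrite -meanZ; apply: eq_mean => i _; rewrite -expRD; congr expR; ring.
rewrite ler_piMr ?expR_ge0 //.
apply: (@le_trans _ _ (E A (fun c' => th * (g c' - g c) +
    (1 + 2 * th ^+ 2 * B ^+ 2)) c)).
  apply: E_le => i _; have := gB i; set y := _ - _ => yB.
  have thy : `|th * y| <= 1 / 2.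
    by rewrite normrM ger0_norm // (le_trans _ thB) // ler_wpM2l.
  apply: le_trans (expR_le_quad thy) _.
  have : y ^+ 2 <= B ^+ 2 by rewrite -real_normK ?num_real // lerXn2r ?nnegrE // (le_trans _ yB).
  have : 0 <= th ^+ 2 by exact: sqr_ge0.
  by rewrite exprMn; nra.
rewrite meanD meanZ meanB !E_cst //.
have : th * (2 * th * B ^+ 2) <= th * e by rewrite ler_wpM2l.
have : th * (E A g c - g c) <= th * (- e) by rewrite ler_wpM2l //; lra.
by rewrite expr2; lra.
Qed.

Lemma exp_rate (B e : R) : 0 <= B -> 0 < e ->
  exists th, [/\ 0 < th, th * B <= 1 / 2 & 2 * th * B ^+ 2 <= e].
Proof.
move=> B0 e0; pose m := Num.min 1 e.
have m0 : 0 < m by rewrite lt_min ltr01.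
have m1 : m <= 1 by rewrite ge_min lexx.
have me : m <= e by rewrite ge_min lexx orbT.
pose D := (B + 1) ^+ 2; have D0 : 0 < D by rewrite exprn_gt0 //; lra.
exists (m / (2 * D)); split.
- by rewrite divr_gt0 // mulr_gt0.
- by rewrite mulrAC ler_pdivrMr ?mulr_gt0 // /D; nra.
- have -> : 2 * (m / (2 * D)) * B ^+ 2 = m * (B ^+ 2 / D) by field; rewrite gt_eqF.
  apply: le_trans me; rewrite ler_piMr ?(ltW m0) // ler_pdivrMr // mul1r.
  by rewrite /D; nra.
Qed.

(* [min 1 (\sum_j exp (th * g j))] is a supermartingale. *)
Lemma unstable_of_drift (T : choiceType) (K : T -> T -> R) A (ch : chart L K A)
    (C : set T) (J : finType) (g : J -> cstate -> R) (B e : R) :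
  irreducible_class K C -> (exists2 v, C v & exists j, 0 <= g j (emb ch v)) ->
  (forall j x i, g j (chart_proj ch x, i) = g j (x, i)) -> 0 <= B -> 0 < e ->
  (forall j c i, `|g j (@cmv _ _ L c i) - g j c| <= B) ->
  (forall c, dom A c -> (exists j, 0 <= g j c) \/ forall j, E A (g j) c <= g j c - e) ->
  (forall m : R, exists2 c, dom A c & forall j, g j c <= - m) ->
  unstable K C.
Proof.
move=> irr [v Cv [jv gv]] gpi B0 e0 gB dg low.
have [th [th0 thB thB2]] := exp_rate B0 e0.
pose S c := \sum_j expR (th * g j c).
pose phi c := Num.min 1 (S c).
have S0 c : 0 <= S c by apply: sumr_ge0 => j _; exact: expR_ge0.
have S1 c j : 0 <= g j c -> 1 <= S c.
  move=> gj; rewrite /S (bigD1 j) //=.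
  have : 1 <= expR (th * g j c) by rewrite -[leLHS]expR0 ler_expR mulr_ge0 // ltW.
  have : 0 <= \sum_(k | k != j) expR (th * g k c) by apply: sumr_ge0 => k _; exact: expR_ge0.
  lra.
have phipi x i : phi (chart_proj ch x, i) = phi (x, i).
  by rewrite /phi /S; congr Num.min; apply: eq_bigr => j _; rewrite gpi.
have Ephi c : dom A c -> E A phi c <= phi c.
  move=> dc; rewrite {2}/phi le_min; apply/andP; split.
    by rewrite -[leRHS](E_cst _ dc); apply: E_le => i _; rewrite ge_min lexx.
  (* Where some [g j] is nonnegative, phi takes its maximal value 1 and no drift is required. *)
  have [[j gj]|gd] := dg c dc.
    apply: le_trans (S1 c j gj); rewrite -[leRHS](E_cst _ dc).
    by apply: E_le => i _; rewrite ge_min lexx.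
  apply: (@le_trans _ _ (E A S c)); first by apply: E_le => i _; rewrite ge_min lexx orbT.
  rewrite /S mean_sum; apply: ler_sum => j _.
  by apply: (exp_supermartingale dc (gB j c) (gd j)) => //; exact: ltW.
(* At this depth each exponential is at most exp(-#|J|), and #|J| exp(-#|J|) < 1. *)
have [c dc gc] := low (#|J|%:R / th).
have [u eu] := emb_surj ch dc.
rewrite (chart_kernel ch) in irr *.
apply: (unstable_of_supermartingale (chart_wt_ge0 ch) (chart_wt_sum1 ch)
  (phi := fun u => phi (emb ch u)) (v := v) (x := u) irr) => //.
- by move=> z; rewrite le_min ler01 S0.
- by move=> z; rewrite chart_expect // Ephi // emb_dom.
- by rewrite /phi le_min lexx (S1 _ jv).
rewrite eu phipi -surjective_pairing /phi gt_min ltxx /=.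
have J0 : (0 < #|J|)%N by apply/card_gt0P; exists jv.
apply: (@le_lt_trans _ _ (\sum_(j : J) expR (- #|J|%:R))).
  apply: ler_sum => j _; rewrite ler_expR.
  by have := gc j; rewrite -(ler_pM2l th0) mulrN mulrC [th * (_ / _)]mulrC divfK ?gt_eqF.
rewrite sumr_const expRN -[X in X < _]mulr_natl ltr_pdivrMr ?expR_gt0 // mul1r.
by apply: lt_le_trans (expR_ge1Dx _); rewrite ltrDr.
Qed.

Lemma sum_unit (r : R) l (F : 'I_d -> R) :
  \sum_k r * (k == l)%:R * F k = r * F l.
Proof.
rewrite (bigD1 l) //= eqxx mulr1 big1 ?addr0 // => k /negPf ->.
by rewrite mulr0 mul0r.
Qed.

Lemma lin_unit (r : R) l c : lin (fun k => r * (k == l)%:R) c = r * (c.1 l)%:~R.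
Proof. exact: sum_unit. Qed.

Lemma corrected_bound al w (W k : R) c i : (forall c, `|w c| <= W) ->
  `|(lin al (@cmv _ _ L c i) + w (cmv c i) + k) - (lin al c + w c + k)| <=
  lin_norm al + W + W.
Proof.
move=> wW; have := lin_cmv_bound al c i; have := wW c; have := wW (cmv c i).
rewrite !ler_norml => /andP[h1 h2] /andP[h3 h4] /andP[h5 h6].
by apply/andP; split; lra.
Qed.

Lemma dom_axis A l (n : nat) : dom A ([ffun k => if k == l then n%:Z else 0], 0%N).
Proof.
apply/andP; split; last exact: phases_gt0.
by apply/forallP => k; rewrite ffunE; case: eqP; rewrite implybT.
Qed.

Lemma drift_pos_not_stable A l (a : 'I_d -> R) : one_free A -> l \notin A ->
  mean_drift L [set: 'I_d]%SET a -> 0 < a l ->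
  ~ induced_semi_irreducible_stable L A.
Proof.
move=> A1 lA ma al0 [C [[irr _ _] st]]; have [[v Cv] _ _] := irr.
apply: (stable_not_unstable _ st); first by exists v.
pose al k : R := -1 * (k == l)%:R.
have neg : \sum_k al k * a k < 0 by rewrite sum_unit mulN1r oppr_lt0.
have [w [W [e [e0 W0 wW winv Hi]]]] := full_corrector ma neg.
pose ch := ind_chart L A.
(* The shift makes the functional nonnegative near the boundary, through 1 + W, and at v, through
   the absolute value. *)
pose k0 := 1 + W + `|lin al (emb ch v) + w (emb ch v)|.
apply: (@unstable_of_drift _ _ _ ch C unit
  (fun _ c => lin al c + w c + k0) (lin_norm al + W + W) e) => //.
- exists v => //; exists tt; rewrite /k0.
  have := ler_norm (- (lin al (emb ch v) + w (emb ch v))); rewrite normrN; lra.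
- move=> _ x i; rewrite /al !lin_unit /= ffunE (negPf lA).
  by rewrite (winv _ x).
- by have := lin_norm_ge0 al; lra.
- by move=> _ c i; exact: corrected_bound.
- move=> c dc; have [nc|ic] := near_or_interior A1 dc; last first.
    right=> _; rewrite meanD E_cst //; have := Hi A c dc ic; lra.
  left; exists tt; rewrite /al lin_unit.
  have /forallP/(_ l) := nc; rewrite lA /= -(ler_int R) => h.
  have := wW c; rewrite ler_norml => /andP[h2 _].
  rewrite /k0; have := normr_ge0 (lin al (emb ch v) + w (emb ch v)); lra.
- move=> m; pose n := Num.bound `|W + k0 + m|.
  exists ([ffun k => if k == l then n%:Z else 0], 0%N); first exact: dom_axis.
  move=> _; rewrite /al lin_unit /= ffunE eqxx.
  set c := (_, _); have := wW c; rewrite ler_norml => /andP[_ h2].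
  have h := archi_boundP (normr_ge0 (W + k0 + m)).
  have h3 := ler_norm (W + k0 + m).
  have : `|W + k0 + m| < (n%:Z)%:~R :> R by exact: h.
  lra.
Qed.

Lemma iter_E_cst A n (k : R) c : dom A c -> iter n (E A) (fun=> k) c = k.
Proof.
elim: n c => [//|n IH] c dc; rewrite iterS -[RHS](E_cst k dc).
by apply: eq_mean => i /cwt_neq0/andP[_]; exact: IH.
Qed.

Lemma iter_E_affine A n (k b : R) f c : dom A c ->
  iter n (E A) (fun c => k * f c + b) c = k * iter n (E A) f c + b.
Proof.
elim: n c => [//|n IH] c dc; rewrite !iterS -[X in _ = _ + X](E_cst b dc) -meanZ -meanD.
by apply: eq_mean => i /cwt_neq0/andP[_]; exact: IH.
Qed.

Lemma iter_E_ge0 A n f c : (forall c, dom A c -> 0 <= f c) -> dom A c ->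
  0 <= iter n (E A) f c.
Proof. by move=> f0 dc; rewrite -(iter_E_cst n 0 dc); exact: iter_E_le. Qed.

Lemma dom_ge0 A c l : l \notin A -> dom A c -> 0 <= c.1 l.
Proof. by move=> lA /andP[/forallP/(_ l)]; rewrite lA. Qed.

Lemma dom_origin A : dom A ([ffun=> 0], 0%N).
Proof.
apply/andP; split; last exact: phases_gt0.
by apply/forallP => k; rewrite ffunE implybT.
Qed.

(** Under transience the mean of a nonnegative coordinate, started from 0, would be at most C - e n
    for every n. *)
Lemma drift_neg_not_transient A l (a : 'I_d -> R) : one_free A -> l \notin A ->
  mean_drift L [set: 'I_d]%SET a -> a l < 0 -> ~ induced_transient L A.
Proof.
move=> A1 lA ma al0 tr; pose al k : R := 1 * (k == l)%:R.
have neg : \sum_k al k * a k < 0 by rewrite sum_unit mul1r.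
have [w [W [e [e0 W0 wW winv Hi]]]] := full_corrector ma neg.
have [C HC] := transient_gain A1 e0 wW (Hi A) tr.
apply: (@archi_absurd C e) => // n; have := HC n _ (dom_origin A).
have f0 c : dom A c -> 0 <= lin al c.
  by move=> dc; rewrite lin_unit mul1r ler0z (dom_ge0 lA dc).
have := iter_E_ge0 n f0 (dom_origin A).
by rewrite /gain [lin al _ in X in _ -> X]lin_unit /= ffunE mulr0; lra.
Qed.

(** In this mode every state is near the boundary, so n steps give occupation time n, against
    [near_green]. *)
Lemma full_not_transient : ~ induced_transient L [set: 'I_d]%SET.
Proof.
move=> /near_green[G HG]; apply: (@archi_absurd G 1) => // n.
rewrite mul1r; apply: le_trans (HG n _ (dom_origin _)).
rewrite (eq_bigr (fun=> 1)); first by rewrite sumr_const card_ord.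
move=> k _; rewrite -[RHS](iter_E_cst k 1 (dom_origin [set: 'I_d]%SET)).
congr (iter _ _ _ _); apply/funext => c.
by rewrite (_ : near_boundary _ _) //; apply/forallP => i; rewrite inE.
Qed.

(* The square of a corrected coordinate grows at most linearly in mean, hence the
   coordinate itself at most like a square root. *)
Lemma induced_drift_le0 A l (a aA : 'I_d -> R) : one_free A -> l \notin A ->
  mean_drift L [set: 'I_d]%SET a -> a l < 0 -> mean_drift L A aA -> aA l <= 0.
Proof.
move=> A1 lA ma al0 mA; rewrite leNgt; apply/negP => aA0.
pose al k : R := 1 * (k == l)%:R.
have neg : \sum_k al k * a k < 0 by rewrite sum_unit mul1r.
have [w [W [e [e0 W0 wW winv Hi]]]] := full_corrector ma neg.
pose F c := lin al c + w c + W.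
pose B := lin_norm al + W + W.
have B0 : 0 <= B by have := lin_norm_ge0 al; rewrite /B; lra.
have FB c i : `|F (@cmv _ _ L c i) - F c| <= B by exact: corrected_bound.
have fF c : lin al c <= F c.
  by rewrite /F; have := wW c; rewrite ler_norml => /andP[h _]; lra.
have f0 c : dom A c -> 0 <= lin al c.
  by move=> dc; rewrite lin_unit mul1r ler0z (dom_ge0 lA dc).
(* The squared increment of F contributes B^2; the cross term can be positive only near the
   boundary, where F is at most 1 + 2 W. *)
pose M := 2 * (1 + W + W) * B + B ^+ 2.
have M0 : 0 <= M by rewrite /M; nra.
have EF2 c : dom A c -> E A (fun c => F c ^+ 2) c <= F c ^+ 2 + M.
  move=> dc; apply: (@le_trans _ _ (E A (fun c' => 2 * F c * F c' +
      (B ^+ 2 - F c ^+ 2)) c)).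
    apply: E_le => i _; have := FB c i.
    have : (F (cmv c i) - F c) ^+ 2 <= B ^+ 2.
      by rewrite -real_normK ?num_real // lerXn2r ?nnegrE.
    by rewrite sqrrB; lra.
  rewrite meanD E_cst // meanZ.
  have F0 : 0 <= F c by apply: le_trans (f0 _ dc) (fF c).
  have [nc|ic] := near_or_interior A1 dc; last first.
    have : E A F c <= F c by rewrite /F meanD E_cst //; have := Hi A c dc ic; lra.
    rewrite /M; nra.
  have F1 : F c <= 1 + W + W.
    rewrite /F lin_unit mul1r; have /forallP/(_ l) := nc.
    rewrite lA /= -(ler_int R) => h.
    by have := wW c; rewrite ler_norml => /andP[_ h2]; lra.
  have : E A F c <= F c + B.
    rewrite -[X in _ <= X](E_cst _ dc); apply: E_le => i _.
    by have := FB c i; rewrite ler_norml => /andP[_ h]; lra.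
  rewrite /M; nra.
have it n c : dom A c -> iter n (E A) (fun c => F c ^+ 2) c <= F c ^+ 2 + n%:R * M.
  elim: n c => [|n IH] c dc; first by rewrite mul0r addr0.
  rewrite iterS; apply: (@le_trans _ _ (E A (fun c => F c ^+ 2) c + n%:R * M)).
    by apply: EB_le => // i di; exact: IH.
  by have := EF2 c dc; rewrite -natr1; lra.
pose c0 : cstate := ([ffun=> 0], 0%N); have d0 : dom A c0 := dom_origin A.
have cv := gain_lin_cvg (al := al) mA d0; rewrite sum_unit mul1r in cv.
have : aA l / 2 < aA l by lra.
move=> /(cvgr_gt _ cv)[n0 _ Hn0].
pose s := aA l / 2; have s0 : 0 < s by rewrite /s; lra.
have lc0 : lin al c0 = 0 by rewrite lin_unit ffunE mulr0.
apply: (@archi_absurd (F c0 ^+ 2 + M + s ^+ 2 * n0.+1%:R) (s ^+ 2)) => [|n].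
  by rewrite exprn_gt0.
have Fsq : 0 <= F c0 ^+ 2 by exact: sqr_ge0.
have ssq : 0 <= s ^+ 2 by exact: sqr_ge0.
have [nn|nn] := leqP n n0.
  have : n%:R <= n0.+1%:R :> R by rewrite ler_nat (leq_trans nn).
  by move=> h; have := ler_wpM2l ssq h; lra.
have n1 : 1 <= n%:R :> R by rewrite ler1n (leq_trans _ nn).
have := Hn0 n (ltnW nn); rewrite -/s /gain lc0 subr0 ltr_pdivlMr; last by lra.
have sn : 0 < s * n%:R by rewrite mulr_gt0 //; lra.
(* The arithmetic-geometric inequality bounds the first moment by the second; with weight s n it
   leads to s^2 n <= F(c0)^2 + M, which fails for large n. *)
have fle c : dom A c -> lin al c <= (2 * (s * n%:R))^-1 * F c ^+ 2 + s * n%:R / 2.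
  move=> dc; apply: le_trans (fF c) _.
  rewrite -subr_ge0 (_ : _ - _ = (F c - s * n%:R) ^+ 2 / (2 * (s * n%:R))).
    by rewrite divr_ge0 ?sqr_ge0 // mulr_ge0 // ltW.
  by field; rewrite !gt_eqF //; lra.
move=> h1; have := iter_E_le n fle d0; rewrite iter_E_affine // => h2.
have h3 : (2 * (s * n%:R))^-1 * iter n (E A) (fun c => F c ^+ 2) c0 <=
    (2 * (s * n%:R))^-1 * (F c0 ^+ 2 + n%:R * M).
  by rewrite ler_wpM2l ?it // invr_ge0 mulr_ge0 // ltW.
have : s * n%:R / 2 < (2 * (s * n%:R))^-1 * (F c0 ^+ 2 + n%:R * M) by lra.
have sn2 : 0 < 2 * (s * n%:R) by rewrite mulr_gt0.
rewrite [X in _ < X -> _]mulrC ltr_pdivlMr // => h4.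
have h5 : n%:R * (s ^+ 2 * n%:R) <= n%:R * (F c0 ^+ 2 + M) by nra.
have := mulr_ge0 ssq (ler0n R n0.+1).
by move: h5; rewrite ler_pM2l; lra.
Qed.

End DriftCriteria.

Lemma intr_le1 (R : realType) (n : int) : n < 2 -> n%:~R <= 1 :> R.
Proof. by move=> n2; rewrite -[leRHS]/(1%:~R) ler_int; lia. Qed.

Lemma absz_ltn (R : realType) (n : int) (m : nat) : 0 <= n ->
  ~~ (m%:R <= n%:~R :> R) -> (`|n| < m)%N.
Proof. by move=> n0; rewrite -ltNge -[m%:R]/(m%:Z%:~R) ltr_int; lia. Qed.

(** * Correctors with at most one reflected coordinate *)

Section EdgeCorrector.
Context {R : realType} {d : nat} (L : mmrrw R d).
Notation pos := {ffun 'I_d -> int}.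
Notation cstate := (pos * nat)%type.
Notation dom := (dom L).
Notation E A := (expect (cwt (L := L) A) (@cmv R d L)).

(** The interior drift gives a first corrector. The boundary is handled by the drift of mode A or by
    the bounded occupation time; either gives a uniform gain bound, from which the final corrector
    is built. *)
Lemma edge_corrector (A : {set 'I_d}) (aD : 'I_d -> R) (al : 'I_d -> R) :
  one_free A -> mean_drift L [set: 'I_d]%SET aD -> \sum_k al k * aD k < 0 ->
  (exists2 aA, mean_drift L A aA & \sum_k al k * aA k < 0) \/ induced_transient L A ->
  exists (w : cstate -> R) (W e : R), [/\ 0 < e, 0 <= W, forall c, `|w c| <= W &
    forall c, dom A c -> E A (fun c => lin al c + w c) c <= lin al c + w c - e].
Proof.
move=> A1 mD negD H; have [w [W [e [e0 W0 wW _ Hi]]]] := full_corrector mD negD.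
have [e' e'0 [C HC]] : exists2 e : R, 0 < e & exists C : R, forall n c, dom A c ->
    gain L A (lin al) n c <= C - e * n%:R.
  have [[aA mA negA]|tr] := H.
    have [e2 [C [e20 C0 HC]]] := near_gain mA negA.
    exact: stable_gain A1 e0 e20 wW (Hi A) HC.
  have [C HC] := transient_gain A1 e0 wW (Hi A) tr.
  by exists e => //; exists C.
have [w' [W' [e2 [e20 wW' _ Hw]]]] := corrector_of_gain e'0 HC.
by exists w', W', e2; split => //; exact: le_trans (normr_ge0 _) (wW' (0, 0%N)).
Qed.

End EdgeCorrector.

(** * The quadrant *)

Section Quadrant.
Context {R : realType} (L : mmrrw R 2).
Notation pos := {ffun 'I_2 -> int}.
Notation cstate := (pos * nat)%type.
Notation dom := (dom L).
Notation E A := (expect (cwt (L := L) A) (@cmv R 2 L)).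
Notation full := [set: 'I_2]%SET.
Notation empty := (finset.set0 : {set 'I_2}).
Variables (l l' : 'I_2).
Hypothesis ll' : l != l'.

Lemma other_coord k : k != l -> k = l'.
Proof.
move: ll'; rewrite -!val_eqE => H1 H2; apply/val_inj.
have := ltn_ord k; have := ltn_ord l; have := ltn_ord l'; move: H1 H2 => /=; lia.
Qed.

Lemma sum2 (F : 'I_2 -> R) : \sum_k F k = F l + F l'.
Proof.
rewrite (bigD1 l) //= (bigD1 l') 1?eq_sym //= big1 ?addr0 // => k /andP[/other_coord ->].
by rewrite eqxx.
Qed.

Lemma forall2 (P : 'I_2 -> Prop) : P l -> P l' -> forall k, P k.
Proof.
by move=> Pl Pl' k; have [->//|/other_coord ->] := eqVneq k l.
Qed.

Lemma edge_one_free : one_free [set l]%SET.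
Proof. by move=> k k'; rewrite !inE => /other_coord -> /other_coord ->. Qed.

Lemma edge_notin : l' \notin [set l]%SET.
Proof. by rewrite inE eq_sym. Qed.

Lemma empty_edge_alike (x : pos) : 2 <= x l -> alike empty [set l]%SET x x.
Proof.
move=> xl; apply/forallP => k; rewrite !inE.
by have [->|_] := eqVneq k l.
Qed.

Lemma empty_full_alike (x : pos) : 2 <= x l -> 2 <= x l' -> alike empty full x x.
Proof.
move=> xl xl'; apply/forallP; apply: forall2; by rewrite !inE.
Qed.

Lemma edge_drift (g : cstate -> R) (e : R) c :
  (forall c, dom [set l]%SET c -> E [set l]%SET g c <= g c - e) ->
  dom empty c -> 2 <= c.1 l -> E empty g c <= g c - e.
Proof.
case: c => x j H dc /empty_edge_alike al_x; rewrite (E_alike L _ _ al_x).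
by apply: H; rewrite -(alike_dom L _ al_x).
Qed.

Lemma full_drift (g : cstate -> R) (e : R) c :
  (forall c, dom full c -> E full g c <= g c - e) ->
  dom empty c -> 2 <= c.1 l -> 2 <= c.1 l' -> E empty g c <= g c - e.
Proof.
case: c => x j H dc xl xl'; have al_x := empty_full_alike xl xl'.
rewrite (E_alike L _ _ al_x).
by apply: H; rewrite -(alike_dom L _ al_x).
Qed.

(** The instability criterion is applied to -x_l + b x_l', which is very negative only far out in
    the direction of the l-axis, where the walk looks like mode {l}. *)
Lemma walk_unstable_edge (C : set (state L)) (aD aA : 'I_2 -> R) :
  irreducible_class (transition L) C ->
  (exists u : state L, (forall k : 'I_2, tag u k = 0%N) /\ C u) ->
  mean_drift L full aD -> mean_drift L [set l]%SET aA ->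
  aD l' < 0 -> 0 < aA l -> unstable (transition L) C.
Proof.
move=> irr [u [u0 Cu]] mD mA aD0 aA0.
have aA0' := induced_drift_le0 edge_one_free edge_notin mD aD0 mA.
(* With this b the functional is at most -1 on [aD], whatever the sign of [aD l]; on [aA] the term
   with b is at most 0. *)
pose b : R := (`|aD l| + 1) / - aD l'.
have b0 : 0 <= b by rewrite divr_ge0 ?addr_ge0 // oppr_ge0 ltW.
pose al k : R := if k == l then -1 else b.
have all : al l = -1 by rewrite /al eqxx.
have all' : al l' = b by rewrite /al eq_sym (negPf ll').
have negD : \sum_k al k * aD k < 0.
  have -> : \sum_k al k * aD k = - aD l - (`|aD l| + 1).
    by rewrite sum2 all all' /b; field; rewrite lt_eqF.
  have := ler_norm (- aD l); rewrite normrN; lra.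
have negA : \sum_k al k * aA k < 0.
  rewrite sum2 all all'; have : b * aA l' <= 0 by rewrite mulr_ge0_le0.
  lra.
have [] := edge_corrector edge_one_free mD negD.
  by left; exists aA.
move=> w [W [e [e0 W0 wW Hw]]].
have linE c : lin al c = - (c.1 l)%:~R + b * (c.1 l')%:~R.
  by rewrite /lin sum2 all all' mulN1r.
apply: (@unstable_of_drift _ _ L _ _ _ (walk_chart L) C unit
  (fun _ c => lin al c + w c + (1 + W)) (lin_norm al + W + W) e) => //.
- exists u => //; exists tt; rewrite linE /= !ffunE !u0 oppr0 mulr0 add0r.
  by have := wW (emb (walk_chart L) u); rewrite ler_norml => /andP[]; lra.
- by have := lin_norm_ge0 al; lra.
- by move=> _ c i; exact: corrected_bound.
- move=> c dc; have [xl|xl] := leP 2 (c.1 l).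
    right=> _; rewrite meanD E_cst //; have := edge_drift Hw dc xl; lra.
  left; exists tt; rewrite linE.
  have := intr_le1 R xl.
  have : 0 <= b * (c.1 l')%:~R.
    by rewrite mulr_ge0 // ler0z (dom_ge0 _ dc) // inE.
  by have := wW c; rewrite ler_norml => /andP[]; lra.
move=> m; pose n := Num.bound `|W + W + 1 + m|.
exists ([ffun k => if k == l then n%:Z else 0], 0%N); first exact: dom_axis.
move=> _; rewrite linE /= !ffunE eqxx eq_sym (negPf ll') mulr0 addr0.
set c := (_, _); have := wW c; rewrite ler_norml => /andP[_ h2].
have h := archi_boundP (normr_ge0 (W + W + 1 + m)).
have h3 := ler_norm (W + W + 1 + m).
have : `|W + W + 1 + m| < (n%:Z)%:~R :> R by exact: h.
lra.
Qed.

(** One functional per coordinate is used: where either coordinate is below 2, its own functional is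
    nonnegative, and elsewhere both have interior drift. *)
Lemma walk_unstable_interior (C : set (state L)) (aD : 'I_2 -> R) :
  irreducible_class (transition L) C ->
  (exists u : state L, (forall k : 'I_2, tag u k = 0%N) /\ C u) ->
  mean_drift L full aD -> 0 < aD l -> 0 < aD l' -> unstable (transition L) C.
Proof.
move=> irr [u [u0 Cu]] mD aD0 aD0'.
have full1 : one_free full by move=> k k'; rewrite inE.
have corr k : 0 < aD k -> exists (w : cstate -> R) (W e : R),
    [/\ 0 < e, 0 <= W, forall c, `|w c| <= W &
    forall c, dom full c -> E full (fun c => lin (fun i => -1 * (i == k)%:R) c + w c) c
        <= lin (fun i => -1 * (i == k)%:R) c + w c - e].
  move=> ak; have [|w [W [e [e0 W0 wW _ Hw]]]] :=
    full_corrector (al := fun i => -1 * (i == k)%:R) mD.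
    by rewrite sum_unit mulN1r oppr_lt0.
  exists w, W, e; split => // c dc; apply: Hw => //.
  by apply/forallP => i; rewrite inE.
have [w [W [e [e0 W0 wW Hw]]]] := corr l aD0.
have [w' [W' [e' [e'0 W'0 wW' Hw']]]] := corr l' aD0'.
pose g (j : bool) c := if j then lin (fun i => -1 * (i == l)%:R) c + w c + (1 + W)
  else lin (fun i => -1 * (i == l')%:R) c + w' c + (1 + W').
pose B := lin_norm (fun i : 'I_2 => -1 * (i == l)%:R : R) +
  lin_norm (fun i : 'I_2 => -1 * (i == l')%:R : R) + W + W + W' + W'.
have n0 := lin_norm_ge0 (fun i : 'I_2 => -1 * (i == l)%:R : R).
have n0' := lin_norm_ge0 (fun i : 'I_2 => -1 * (i == l')%:R : R).
apply: (@unstable_of_drift _ _ L _ _ _ (walk_chart L) C bool g B (Num.min e e')) => //.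
- exists u => //; exists true; rewrite /g lin_unit /= ffunE u0 mulr0.
  by have := wW (emb (walk_chart L) u); rewrite ler_norml => /andP[]; lra.
- by rewrite /B; lra.
- by rewrite lt_min e0.
- move=> [] c i; rewrite /g /B.
    by apply: le_trans (corrected_bound _ _ _ _ wW) _; lra.
  by apply: le_trans (corrected_bound _ _ _ _ wW') _; lra.
- move=> c dc; have [xl|xl] := leP 2 (c.1 l); last first.
    left; exists true; rewrite /g lin_unit.
    have := intr_le1 R xl.
    by have := wW c; rewrite ler_norml => /andP[]; lra.
  have [xl'|xl'] := leP 2 (c.1 l'); last first.
    left; exists false; rewrite /g lin_unit.
    have := intr_le1 R xl'.
    by have := wW' c; rewrite ler_norml => /andP[]; lra.
  right=> -[]; rewrite /g meanD E_cst //.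
    have := full_drift Hw dc xl xl'; have : Num.min e e' <= e by rewrite ge_min lexx.
    lra.
  have := full_drift Hw' dc xl xl'; have : Num.min e e' <= e' by rewrite ge_min lexx orbT.
  lra.
move=> m; pose r := W + W + 1 + m; pose r' := W' + W' + 1 + m.
pose n := Num.bound (`|r| + `|r'|).
exists ([ffun=> n%:Z], 0%N).
  apply/andP; split; last exact: phases_gt0.
  by apply/forallP => k; rewrite ffunE implybT.
have h : `|r| + `|r'| < (n%:Z)%:~R :> R.
  by apply: (archi_boundP (_ : 0 <= `|r| + `|r'|)); exact: addr_ge0.
have := ler_norm r; have := ler_norm r'; have := normr_ge0 r; have := normr_ge0 r'.
move=> h1 h2 h3 h4 [];
  rewrite /g lin_unit /= ffunE; set c := (_, _).
  by have := wW c; rewrite ler_norml => /andP[_]; move: h3 h4; rewrite /r; lra.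
by have := wW' c; rewrite ler_norml => /andP[_]; move: h3 h4; rewrite /r'; lra.
Qed.

End Quadrant.

(** * A quadratic Lyapunov function *)

Section QuadraticLyapunov.
Context {R : realType} (L : mmrrw R 2).
Notation pos := {ffun 'I_2 -> int}.
Notation cstate := (pos * nat)%type.
Notation dom := (dom L).
Notation E A := (expect (cwt (L := L) A) (@cmv R 2 L)).
Notation full := [set: 'I_2]%SET.
Notation empty := (finset.set0 : {set 'I_2}).
Variables (l l' : 'I_2).
Hypothesis ll' : l != l'.

Definition two (a b : R) (k : 'I_2) : R := if k == l then a else b.

Lemma sum_two a b (F : 'I_2 -> R) : \sum_k two a b k * F k = a * F l + b * F l'.
Proof. by rewrite (sum2 ll') /two eqxx eq_sym (negPf ll'). Qed.

Lemma lin_two a b (c : cstate) : lin (two a b) c = a * (c.1 l)%:~R + b * (c.1 l')%:~R.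
Proof. exact: sum_two. Qed.

Lemma mul_bound (z u W : R) : `|z| <= 1 -> `|u| <= W -> z * u <= W.
Proof.
move=> z1 uW; apply: le_trans (ler_norm _) _; rewrite normrM.
by apply: le_trans uW; rewrite ler_piMl.
Qed.

Lemma edge_term (G : cstate -> R) (B e : R) k c : 0 <= B -> 0 < e ->
  (forall c i, `|G (@cmv _ _ L c i) - G c| <= B) ->
  (forall c, dom [set k]%SET c -> E [set k]%SET G c <= G c - e) ->
  dom empty c ->
  (c.1 k)%:~R * (E empty G c - G c) <= B + e - e * (c.1 k)%:~R.
Proof.
move=> B0 e0 GB HG dc; have ck : 0 <= c.1 k by rewrite (dom_ge0 _ dc) // inE.
have ck' : 0 <= (c.1 k)%:~R :> R by rewrite ler0z.
have [xl|xl] := leP 2 (c.1 k).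
  have : E empty G c - G c <= - e by have := edge_drift HG dc xl; lra.
  by move/(ler_wpM2l ck'); lra.
have c1 := intr_le1 R xl.
have EB : E empty G c - G c <= B.
  rewrite lerBlDl -[X in _ <= X](E_cst _ dc); apply: E_le => i _.
  by have := GB c i; rewrite ler_norml => /andP[]; lra.
have : (c.1 k)%:~R * (E empty G c - G c) <= B.
  apply: le_trans (ler_wpM2l ck' EB) _; by rewrite ler_piMl.
have : e * (c.1 k)%:~R <= e by rewrite ler_piMr // ltW.
lra.
Qed.

(* The Lyapunov function is the quadratic form
   [al * x ^+ 2 + 2 * be * x * y + ga * y ^+ 2], whose partial derivatives are
   twice the two linear functionals, corrected by [2 * x * w + 2 * y * w']. *)
Lemma walk_stable_quadratic (C : set (state L)) (al be ga : R)
    (w w' : cstate -> R) (W W' e e' : R) :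
  semi_irreducible (transition L) C -> 0 < al -> 0 <= be -> 0 < ga ->
  0 < e -> 0 < e' -> 0 <= W -> 0 <= W' ->
  (forall c, `|w c| <= W) -> (forall c, `|w' c| <= W') ->
  (forall c, dom [set l]%SET c -> E [set l]%SET (fun c => lin (two al be) c + w c) c
     <= lin (two al be) c + w c - e) ->
  (forall c, dom [set l']%SET c -> E [set l']%SET (fun c => lin (two be ga) c + w' c) c
     <= lin (two be ga) c + w' c - e') ->
  stable (transition L) C.
Proof.
move=> irr al0 be0 ga0 e0 e'0 W0 W'0 wW wW' Hw Hw'.
pose x (c : cstate) : R := (c.1 l)%:~R; pose y (c : cstate) : R := (c.1 l')%:~R.
pose F c := lin (two al be) c + w c; pose F' c := lin (two be ga) c + w' c.
pose B := lin_norm (two al be) + W + W; pose B' := lin_norm (two be ga) + W' + W'.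
have B0 : 0 <= B by have := lin_norm_ge0 (two al be); rewrite /B; lra.
have B'0 : 0 <= B' by have := lin_norm_ge0 (two be ga); rewrite /B'; lra.
have FB c i : `|F (@cmv _ _ L c i) - F c| <= B.
  by have := corrected_bound (two al be) 0 c i wW; rewrite !addr0.
have FB' c i : `|F' (@cmv _ _ L c i) - F' c| <= B'.
  by have := corrected_bound (two be ga) 0 c i wW'; rewrite !addr0.
(* This constant completes the squares in x and y, which keeps V nonnegative on the quadrant. *)
pose ka := W ^+ 2 / al + W' ^+ 2 / ga.
pose V c := al * x c ^+ 2 + 2 * be * x c * y c + ga * y c ^+ 2
            + 2 * x c * w c + 2 * y c * w' c + ka.
have x0 c : dom empty c -> 0 <= x c by move=> dc; rewrite ler0z (dom_ge0 _ dc) // inE.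
have y0 c : dom empty c -> 0 <= y c by move=> dc; rewrite ler0z (dom_ge0 _ dc) // inE.
have sq (s r u U : R) : 0 < s -> 0 <= r -> `|u| <= U ->
    0 <= s * r ^+ 2 + 2 * r * u + U ^+ 2 / s.
  move=> s0 r0; rewrite ler_norml => /andP[h _].
  have : 0 <= (s * r - U) ^+ 2 / s by rewrite divr_ge0 ?sqr_ge0 // ltW.
  have -> : (s * r - U) ^+ 2 / s = s * r ^+ 2 - 2 * r * U + U ^+ 2 / s.
    by field; rewrite gt_eqF.
  have : r * - U <= r * u by rewrite ler_wpM2l.
  lra.
have V0 c : dom empty c -> 0 <= V c.
  move=> dc; have := sq al (x c) (w c) W al0 (x0 _ dc) (wW c).
  have := sq ga (y c) (w' c) W' ga0 (y0 _ dc) (wW' c).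
  have : 0 <= be * x c * y c by rewrite !mulr_ge0 ?x0 ?y0.
  rewrite /V /ka; lra.
(* A bound for all terms of the expansion of V that carry no factor x or y. *)
pose r0 := al + 2 * be + ga + 2 * W + 2 * W'.
have dV c : dom empty c -> E empty V c <=
    V c + r0 + 2 * (B + e - e * x c) + 2 * (B' + e' - e' * y c).
  move=> dc; apply: (@le_trans _ _ (E empty (fun c' => 2 * x c * (F c' - F c) +
     2 * y c * (F' c' - F' c) + (V c + r0)) c)); last first.
    rewrite meanD (E_cst _ dc) meanD !meanZ !meanB !(E_cst _ dc).
    have h : x c * (E empty F c - F c) <= B + e - e * x c := edge_term B0 e0 FB Hw dc.
    have h' : y c * (E empty F' c - F' c) <= B' + e' - e' * y c :=
      edge_term B'0 e'0 FB' Hw' dc.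
    move: h h'; move: (E empty F c) (E empty F' c) => p p'; lra.
  apply: E_le => i _; set c' := cmv c i.
  pose z : R := (incr i.1 l)%:~R; pose z' : R := (incr i.1 l')%:~R.
  have xc : x c' = x c + z by rewrite /x /c' ffunE rmorphD.
  have yc : y c' = y c + z' by rewrite /y /c' ffunE rmorphD.
  have zb (j : 'I_2) : `|(incr i.1 j)%:~R| <= 1 :> R.
    by rewrite -intr_norm -[leRHS]/(1%:~R) ler_int incr_bound.
  have zw := mul_bound (zb l) (wW c'); have zw' := mul_bound (zb l') (wW' c').
  have zz := mul_bound (zb l) (zb l); have zz' := mul_bound (zb l') (zb l').
  have zzz := mul_bound (zb l) (zb l').
  rewrite -/z -/z' in zw zw' zz zz' zzz.
  have t1 : al * (z * z) <= al by rewrite ler_piMr // ltW.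
  have t2 : ga * (z' * z') <= ga by rewrite ler_piMr // ltW.
  have t3 : be * (z * z') <= be by rewrite ler_piMr.
  have -> : V c' = 2 * x c * (F c' - F c) + 2 * y c * (F' c' - F' c) + V c
      + (al * (z * z) + 2 * (be * (z * z')) + ga * (z' * z')
      + 2 * (z * w c') + 2 * (z' * w' c')).
    by rewrite /V /F /F' !lin_two -/(x c) -/(y c) -/(x c') -/(y c') xc yc; ring.
  rewrite /r0; lra.
(* As soon as e x or e' y reaches Q, the bound [dV] gives a decrease by at least 1. *)
pose Q := (1 + r0) / 2 + B + e + B' + e'.
have Q0 : 0 <= Q by rewrite /Q /r0; lra.
pose m := (Num.bound (Q / e) + Num.bound (Q / e'))%N.
have mQ : Q <= e * m%:R /\ Q <= e' * m%:R.
  have h : 0 <= Q / e by rewrite divr_ge0 // ltW.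
  have h' : 0 <= Q / e' by rewrite divr_ge0 // ltW.
  split; rewrite mulrC -ler_pdivrMr //.
    by apply: le_trans (ltW (archi_boundP h)) _; rewrite ler_nat leq_addr.
  by apply: le_trans (ltW (archi_boundP h')) _; rewrite ler_nat leq_addl.
have [u0 _] := emb_surj (walk_chart L) (dom_origin L empty).
pose J : finType := ('I_m * 'I_m * 'I_(max_phases L))%type.
(* The exceptional set consists of the finitely many states with both coordinates below m; triples
   that encode no state are sent to [u0]. *)
pose rep (t : J) : state L := xget u0 [set v | emb (walk_chart L) v =
  ([ffun k => if k == l then (t.1.1 : nat)%:Z else (t.1.2 : nat)%:Z], t.2 : nat)]%classic.
have KE := chart_kernel (walk_chart L); rewrite KE in irr *.
apply: (foster_stable (chart_wt_ge0 (walk_chart L)) (chart_wt_sum1 (walk_chart L))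
  (F := rep) (V := fun v => V (emb (walk_chart L) v)) irr) => [v|v vrep].
  exact: V0 (emb_dom (walk_chart L) v).
rewrite (chart_expect (ch := walk_chart L) (h := V)) //.
set c := emb _ v; have dc : dom empty c := emb_dom (walk_chart L) v.
suff : m%:R <= x c \/ m%:R <= y c.
  have := dV c dc; have [mQ1 mQ2] := mQ.
  have ex : 0 <= e * x c by rewrite mulr_ge0 ?x0 // ltW.
  have ey : 0 <= e' * y c by rewrite mulr_ge0 ?y0 // ltW.
  move=> h [mx|my].
    have h2 : e * m%:R <= e * x c by rewrite ler_pM2l.
    by move: h mQ1; rewrite /Q; lra.
  have h2 : e' * m%:R <= e' * y c by rewrite ler_pM2l.
  by move: h mQ2; rewrite /Q; lra.
apply: contrapT => /not_orP[/negP xm /negP ym].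
have cl : 0 <= c.1 l by rewrite (dom_ge0 _ dc) // inE.
have cl' : 0 <= c.1 l' by rewrite (dom_ge0 _ dc) // inE.
have {}xm := absz_ltn cl xm; have {}ym := absz_ltn cl' ym.
have vM : (c.2 < max_phases L)%N.
  by have /andP[_ vj] := dc; apply: leq_trans vj _; exact: leq_bigmax.
apply: (vrep (Ordinal xm, Ordinal ym, Ordinal vM)).
have ev : c = ([ffun k => if k == l then (`|c.1 l|%N)%:Z else (`|c.1 l'|%N)%:Z], c.2).
  rewrite [LHS]surjective_pairing; congr pair; apply/ffunP => k; rewrite [RHS]ffunE.
  by have [->|/(other_coord ll') ->] := eqVneq k l; rewrite gez0_abs.
rewrite /rep; case: xgetP => [v' _ /= ev'|/(_ v)//].
by apply: (@emb_inj _ _ _ _ _ _ (walk_chart L)); exact: etrans ev (esym ev').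
Qed.

End QuadraticLyapunov.

(** * Stability by the signs of the drifts *)

Section Classification.
Context {R : realType} (L : mmrrw R 2) (S0 : set (state L)).
Notation full := [set: 'I_2]%SET.
Variables (l l' : 'I_2) (aD a1 a2 : 'I_2 -> R).
Hypotheses (ll' : l != l') (hirr : semi_irreducible (transition L) S0).
Hypothesis mD : mean_drift L full aD.

(** The form is x^2 + y^2, so the two functionals are the coordinates themselves. *)
Lemma walk_stable_two_edges :
  aD l < 0 -> aD l' < 0 ->
  mean_drift L [set l]%SET a1 -> mean_drift L [set l']%SET a2 ->
  a1 l < 0 -> a2 l' < 0 -> stable (transition L) S0.
Proof.
move=> aD1 aD2 m1 m2 a11 a22.
have l'l : l' != l by rewrite eq_sym.
have [||w [W [e [e0 W0 wW Hw]]]] :=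
  edge_corrector (al := two l 1 0) (edge_one_free ll') mD.
- by rewrite (sum_two ll') mul1r mul0r addr0.
- by left; exists a1 => //; rewrite (sum_two ll') mul1r mul0r addr0.
have [||w' [W' [e' [e'0 W'0 wW' Hw']]]] :=
  edge_corrector (al := two l 0 1) (edge_one_free l'l) mD.
- by rewrite (sum_two ll') mul1r mul0r add0r.
- by left; exists a2 => //; rewrite (sum_two ll') mul1r mul0r add0r.
exact: (walk_stable_quadratic ll' hirr ltr01 (lexx 0) ltr01 e0 e'0 W0 W'0 wW wW' Hw Hw').
Qed.

(** The form is the perfect square (x + be y)^2, positive on the quadrant away from the origin. Both
    functionals are multiples of x + be y, and for the transient edge only the interior drift has to
    be negative. *)
Lemma walk_stable_one_edge :
  0 < aD l -> aD l' < 0 ->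
  mean_drift L [set l]%SET a1 -> induced_transient L [set l']%SET ->
  a1 l < 0 -> stable (transition L) S0.
Proof.
move=> aD1 aD2 m1 tr a11.
have l'l : l' != l by rewrite eq_sym.
have a12 := induced_drift_le0 (edge_one_free ll') (edge_notin ll') mD aD2 m1.
(* The value of x + be y on [aD] is then -[aD l] < 0. *)
pose be := 2 * aD l / - aD l'.
have be0 : 0 < be by rewrite divr_gt0 ?oppr_gt0 // mulr_gt0.
have beD : be * aD l' = - (2 * aD l) by rewrite /be; field; rewrite lt_eqF.
have [||w [W [e [e0 W0 wW Hw]]]] :=
  edge_corrector (al := two l 1 be) (edge_one_free ll') mD.
- by rewrite (sum_two ll') beD; lra.
- left; exists a1 => //; rewrite (sum_two ll') mul1r.
  have : be * a1 l' <= 0 by rewrite mulr_ge0_le0 // ltW.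
  lra.
have [||w' [W' [e' [e'0 W'0 wW' Hw']]]] :=
  edge_corrector (al := two l be (be ^+ 2)) (edge_one_free l'l) mD.
- rewrite (sum_two ll') expr2 -mulrA beD.
  have : 0 < be * aD l by exact: mulr_gt0.
  lra.
- by right.
exact: (walk_stable_quadratic ll' hirr ltr01 (ltW be0) (exprn_gt0 2 be0)
  e0 e'0 W0 W'0 wW wW' Hw Hw').
Qed.

End Classification.

Theorem theorem3p4 (R : realType) (L : mmrrw R 2) (S0 : set (state L))
    (hirr : semi_irreducible (transition L) S0)
    (hind : forall A : {set 'I_2}, A != finset.set0 ->
       induced_semi_irreducible_stable L A \/ induced_transient L A)
    (horigin : exists u : state L, (forall l : 'I_2, tag u l = 0%N) /\ S0 u)
    (a : {set 'I_2} -> 'I_2 -> R)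
    (ha : forall A : {set 'I_2}, A != finset.set0 ->
       induced_semi_irreducible_stable L A -> mean_drift L A (a A)) :
  let c1 : 'I_2 := ord0 in
  let c2 : 'I_2 := ord_max in
  let aD := a [set: 'I_2]%SET in
  let a1 := a [set c1]%SET in
  let a2 := a [set c2]%SET in
  (* (C1) *)
  [/\ (aD c1 < 0 -> aD c2 < 0 ->
         (a1 c1 < 0 -> a2 c2 < 0 -> stable (transition L) S0) /\
         (0 < a1 c1 \/ 0 < a2 c2 -> unstable (transition L) S0)),
  (* (C2) *)
      (0 < aD c1 -> aD c2 < 0 ->
         (a1 c1 < 0 -> stable (transition L) S0) /\
         (0 < a1 c1 -> unstable (transition L) S0)),
  (* (C3) *)
      (aD c1 < 0 -> 0 < aD c2 ->
         (a2 c2 < 0 -> stable (transition L) S0) /\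
         (0 < a2 c2 -> unstable (transition L) S0)) &
  (* (C4) *)
      (0 < aD c1 -> 0 < aD c2 -> unstable (transition L) S0)].
Proof.
move=> c1 c2 aD a1 a2.
have c12 : c1 != c2 by [].
have c21 : c2 != c1 by [].
have [irr _ _] := hirr.
have nonempty (l : 'I_2) (A : {set 'I_2}) : l \in A -> A != finset.set0.
  by move=> lA; apply/set0Pn; exists l.
have fullN : [set: 'I_2]%SET != finset.set0 by rewrite (nonempty c1) ?inE.
have edgeN l : [set l]%SET != finset.set0 :> {set 'I_2}.
  by rewrite (nonempty l) ?inE.
(* The finite chain L^D cannot be transient, so the dichotomy provides its drift vector. *)
have mD : mean_drift L [set: 'I_2]%SET aD.
  by apply: ha => //; have [//|/full_not_transient] := hind _ fullN.
(* The sign of [aD l'] decides the alternative for the edge l: a negative sign excludes transience,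
   so the drift vector exists, and a positive one excludes stability. *)
have mE l l' : l != l' -> aD l' < 0 -> mean_drift L [set l]%SET (a [set l]%SET).
  move=> ll' aDl'; apply: ha => //; have [//|] := hind _ (edgeN l).
  by move=> /(drift_neg_not_transient (edge_one_free ll') (edge_notin ll') mD aDl').
have trE l l' : l != l' -> 0 < aD l' -> induced_transient L [set l]%SET.
  move=> ll' aDl'; have [|//] := hind _ (edgeN l).
  by move=> /(drift_pos_not_stable (edge_one_free ll') (edge_notin ll') mD aDl').
split=> D1 D2.
- split=> [E1 E2|[E1|E2]].
  + exact: (walk_stable_two_edges c12 hirr mD D1 D2 (mE _ _ c12 D2) (mE _ _ c21 D1)).
  + exact: (walk_unstable_edge c12 irr horigin mD (mE _ _ c12 D2)).
  + exact: (walk_unstable_edge c21 irr horigin mD (mE _ _ c21 D1)).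
- split=> E1.
  + exact: (walk_stable_one_edge c12 hirr mD D1 D2 (mE _ _ c12 D2) (trE _ _ c21 D1)).
  + exact: (walk_unstable_edge c12 irr horigin mD (mE _ _ c12 D2)).
(* The second case with the two coordinates interchanged. *)
- split=> E2.
  + exact: (walk_stable_one_edge c21 hirr mD D2 D1 (mE _ _ c21 D1) (trE _ _ c12 D2)).
  + exact: (walk_unstable_edge c21 irr horigin mD (mE _ _ c21 D1)).
exact: (walk_unstable_interior c12 irr horigin mD).
Qed.
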